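(* Let $\mathcal{G}=(V,E)$ be a finite connected undirected graph with edge weights $\beta_{ij}=\beta_{ji}>0$, $(i\sim j)\in E$. Let $x,y\in V$ be two different vertices, let $\pi_i\ge 0$, $i\in V$, be fixed numbers with $\pi_x,\pi_y>0$, let $\epsilon>0$, and set $\boldsymbol{\varepsilon}=(\varepsilon_i)_{i\in V}=(\pi_i\epsilon)_{i\in V}$. Let $\mu^{\boldsymbol{\varepsilon}}$ be the probability measure on $\mathbb{R}^V\times\mathbb{R}^V\times\mathcal{T}$ and $G^{\boldsymbol{\varepsilon}}_{xy}$ the Green's function defined in the context. Then there is a version $P_{\beta,t}$ of the conditional law of $\mu^{\boldsymbol{\varepsilon}}$ given $t$ that fulfills $$P_{\beta,t}(T=S)=\frac{\prod_{e\in S}\beta_e(t)}{\sum_{S'\in\mathcal{T}}\prod_{e'\in S'}\beta_{e'}(t)}\qquad\text{for } S\in\mathcal{T},$$ where $\beta_e(t):=\beta_{ij}e^{t_i+t_j}$ for $e=(i\sim j)\in E_\rho$. Writing $x\stackrel{T}{\leftrightarrow}y$ if $x$ and $y$ are connected in the spanning tree $T$ through a path which does not use $\rho$, one has $$G_{xy}^{\boldsymbol{\varepsilon}}=\frac{e^{t_x+t_y}}{\varepsilon_x e^{t_x}+\varepsilon_y e^{t_y}}\;P_{\beta,t}\Big(\{(x\sim\rho)\in T\text{ and }x\stackrel{T}{\leftrightarrow}y\}\cup\{(y\sim\rho)\in T\text{ and }x\stackrel{T}{\leftrightarrow}y\}\Big).$$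
   Context: Extended graph: add to $\mathcal{G}=(V,E)$ an extra vertex $\rho$ and an edge $i\sim\rho$ for every $i\in V$: $\mathcal{G}_\rho=(V_\rho,E_\rho)$, $V_\rho=V\cup\{\rho\}$, $E_\rho=E\cup\{(i\sim\rho):i\in V\}$. Edges $(i\sim j)\in E$ carry weights $\beta_{ij}=\beta_{ji}>0$, and the edge $i\sim\rho$ carries the weight $\beta_{i\rho}:=\varepsilon_i\ge0$, with $\varepsilon_i>0$ for at least one $i$. $\mathcal{T}$ is the set of spanning trees of $\mathcal{G}_\rho$; a tree is identified with its edge set. For $t=(t_i)_{i\in V}$, $s=(s_i)_{i\in V}\in\mathbb{R}^V$ put $t_\rho:=0$, $s_\rho:=0$ and, for $i,j\in V_\rho$, $B_{ij}(t,s):=\cosh(t_i-t_j)+\frac12(s_i-s_j)^2e^{t_i+t_j}$. The measure $\mu^{\boldsymbol{\varepsilon}}$ on $\mathbb{R}^V\times\mathbb{R}^V\times\mathcal{T}$ is $$\mu^{\boldsymbol{\varepsilon}}(dt\,ds\,dT):=\prod_{j\in V}\frac{dt_j\,ds_j\,e^{-t_j}}{2\pi}\,dT\prod_{(i\sim j)\in E_\rho}e^{-\beta_{ij}(B_{ij}(t,s)-1)}\prod_{(i\sim j)\in T}\beta_{ij}e^{t_i+t_j},$$ with $dt_j,ds_j$ Lebesgue measure on $\mathbb{R}$ and $dT$ counting measure on $\mathcal{T}$ (in the factor $1/(2\pi)$, $\pi$ is the usual constant, not the family $(\pi_i)$). It is known that $\mu^{\boldsymbol{\varepsilon}}$ is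 a probability measure. The symbols $t,s,T$ also denote the canonical projections on $\mathbb{R}^V\times\mathbb{R}^V\times\mathcal{T}$, regarded as random variables. The matrix $A(t)\in\mathbb{R}^{V\times V}$ has entries $A(t)_{ij}=-\beta_{ij}e^{t_i+t_j}$ if $(i\sim j)\in E$, $A(t)_{jj}=\sum_{k\in V:(k\sim j)\in E}\beta_{kj}e^{t_k+t_j}$, and $0$ otherwise. $\hat{\boldsymbol{\varepsilon}}(t):=\operatorname{diag}(\varepsilon_ie^{t_i},\,i\in V)$. The Green's function is $G_{xy}^{\boldsymbol{\varepsilon}}:=e^{t_x+t_y}\big((A(t)+\hat{\boldsymbol{\varepsilon}}(t))^{-1}\big)_{xy}$. *)

(* Defs.v *)
From HB Require Import structures.
From mathcomp Require Import all_boot all_order all_algebra.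
From mathcomp Require Import all_classical all_reals all_analysis.
From mathcomp Require Import measurable_realfun.

Set Implicit Arguments.
Unset Strict Implicit.
Unset Printing Implicit Defensive.

Import Order.TTheory GRing.Theory Num.Theory.
Import numFieldNormedType.Exports.

Local Open Scope classical_set_scope.
Local Open Scope ring_scope.

Section lebesgue_tuple.
Local Open Scope ereal_scope.
Variable R : realType.
Local Notation T := (measurableTypeR R).

Definition tuple_cons n (p : T * n.-tuple T) : n.+1.-tuple T :=
  [tuple of p.1 :: p.2].

Definition tuple_uncons n (t : n.+1.-tuple T) : T * n.-tuple T :=
  (thead t, [tuple of behead t]).

Lemma measurable_tuple_cons n : measurable_fun setT (@tuple_cons n).
Proof. exact: measurable_cons. Qed.

Lemma measurable_tuple_uncons n : measurable_fun setT (@tuple_uncons n).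
Proof.
apply: measurable_fun_pair; last exact: measurable_behead.
exact: (@measurable_tnth _ T n.+1 ord0).
Qed.

Lemma tuple_consK n : cancel (@tuple_cons n) (@tuple_uncons n).
Proof.
case=> x t; rewrite /tuple_uncons /tuple_cons/= theadE.
by congr pair; exact: val_inj.
Qed.

Lemma tuple_unconsK n : cancel (@tuple_uncons n) (@tuple_cons n).
Proof. by move=> t; rewrite [RHS]tuple_eta. Qed.

(* The product of the Lebesgue measure with m, carried to (n+1)-tuples. *)
Definition lebesgue_cons n (m : {sigma_finite_measure set (n.-tuple T) -> \bar R})
    : set (n.+1.-tuple T) -> \bar R :=
  pushforward (@lebesgue_measure R \x m) (@tuple_cons n).

Section lebesgue_cons.
Variables (n : nat) (m : {sigma_finite_measure set (n.-tuple T) -> \bar R}).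

Let lebesgue_cons0 : lebesgue_cons m set0 = 0.
Proof. by rewrite /lebesgue_cons /pushforward preimage_set0 measure0. Qed.

Let lebesgue_cons_ge0 A : 0 <= lebesgue_cons m A.
Proof. by rewrite /lebesgue_cons /pushforward measure_ge0. Qed.

Let lebesgue_cons_sigma_additive : semi_sigma_additive (lebesgue_cons m).
Proof.
have mf A : measurable A -> measurable (@tuple_cons n @^-1` A).
  by move=> mA; rewrite -[X in measurable X]setTI; exact: measurable_tuple_cons.
move=> F mF tF mUF; rewrite /lebesgue_cons /pushforward preimage_bigcup.
apply: measure_semi_sigma_additive.
- by move=> k; exact: mf.
- by move=> i j _ _ [x [? ?]]; apply: tF => //; exists (tuple_cons x).
- by rewrite -preimage_bigcup; exact: mf.
Qed.

HB.instance Definition _ := isMeasure.Build _ _ _ (lebesgue_cons m)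
  lebesgue_cons0 lebesgue_cons_ge0 lebesgue_cons_sigma_additive.

Let lebesgue_cons_sigma_finite : sigma_finite setT (lebesgue_cons m).
Proof.
have /sigma_finiteP[F [TF ndF Foo]] := sigma_finiteT (@lebesgue_measure R).
have /sigma_finiteP[G [TG ndG Goo]] := sigma_finiteT m.
exists (fun k => @tuple_uncons n @^-1` (F k `*` G k)).
  rewrite -preimage_bigcup (_ : \bigcup_k _ = setT) ?preimage_setT//.
  apply/seteqP; split => // -[x t] _.
  have [k _ Fx] : (\bigcup_k F k) x by rewrite -TF.
  have [l _ Gt] : (\bigcup_k G k) t by rewrite -TG.
  exists (maxn k l) => //; split => /=.
  - by move: x Fx; exact/subsetPset/ndF/leq_maxl.
  - by move: t Gt; exact/subsetPset/ndG/leq_maxr.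
move=> k; have [mF Fk] := Foo k; have [mG Gk] := Goo k; split.
  by rewrite -[X in measurable X]setTI; apply: measurable_tuple_uncons => //;
    exact: measurableX.
rewrite /lebesgue_cons /pushforward -comp_preimage.
rewrite (_ : _ \o _ = id) ?preimage_id; last first.
  by apply/funext => x /=; rewrite tuple_consK.
by rewrite product_measure1E// lte_mul_pinfty// ge0_fin_numE.
Qed.

HB.instance Definition _ := @Measure_isSigmaFinite.Build _ _ _ (lebesgue_cons m)
  lebesgue_cons_sigma_finite.
End lebesgue_cons.

(* Lebesgue measure on R^n; see lebesgue_tuple_box. *)
Fixpoint lebesgue_tuple n : {sigma_finite_measure set (n.-tuple T) -> \bar R} :=
  match n with
  | 0%N => dirac [tuple]
  | n'.+1 => lebesgue_cons (lebesgue_tuple n')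
  end.

Lemma lebesgue_tuple_box n (A : 'I_n -> set T) :
  (forall i, measurable (A i)) ->
  lebesgue_tuple n [set t | forall i, A i (tnth t i)] =
  \prod_(i < n) lebesgue_measure (A i).
Proof.
elim: n A => [|n IHn] A mA.
  rewrite big_ord0 /= diracE mem_set//= => -[].
  by [].
rewrite big_ord_recl /= /lebesgue_cons /pushforward.
pose B := [set t : n.-tuple T | forall i, A (lift ord0 i) (tnth t i)].
have mB : measurable B.
  rewrite (_ : B = \bigcap_(i in [set: 'I_n])
    ((fun t : n.-tuple T => tnth t i) @^-1` A (lift ord0 i))); last first.
    by apply/seteqP; split => t //= Bt i => [_|]; exact: Bt.
  apply: fin_bigcap_measurable; first exact: finite_finset.
  move=> i _; rewrite -[X in measurable X]setTI.
  by apply: measurable_tnth.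
rewrite (_ : _ @^-1` _ = A ord0 `*` B); last first.
  apply/seteqP; split => -[x t] /=.
    move=> H; split; first exact: (H ord0).
    by move=> i; have := H (lift ord0 i); rewrite tnthS.
  move=> [A0 Bt] i; have [j ->|->] := unliftP ord0 i; last exact: A0.
  by rewrite tnthS; exact: Bt.
by rewrite product_measure1E//; congr (_ * _); exact: IHn.
Qed.

End lebesgue_tuple.

Section spanning_trees.
Variables (V : finType) (e : rel V).

(* The extra vertex rho is None; an undirected edge is its set of ends. *)
Definition ext_adj (a b : option V) : bool :=
  match a, b with
  | Some i, Some j => e i j
  | None, None => false
  | _, _ => true
  end.

Definition ext_edges : {set {set option V}} :=
  [set [set p.1; p.2] | p : option V * option V & ext_adj p.1 p.2]%SET.

Definition edge_rel (T : {set {set option V}}) : rel (option V) :=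
  fun a b => ([set a; b] \in T)%SET.

(* Every edge yields a cycle of length 2 in the sense of ucycle, hence the
   bound on the size. *)
Definition acyclic_edges (T : {set {set option V}}) : Prop :=
  forall c : seq (option V), (2 < size c)%N -> ~ ucycle (edge_rel T) c.

Definition is_spanning_tree (T : {set {set option V}}) : Prop :=
  [/\ T \subset ext_edges,
      forall a b, connect (edge_rel T) a b
    & acyclic_edges T].

Definition spanning_tree : Type :=
  {T : {set {set option V}} | `[< is_spanning_tree T >]}.

HB.instance Definition _ := SubFinite.on spanning_tree.

Definition tree_edges (T : spanning_tree) : {set {set option V}} := val T.

(* A measurable type has to be inhabited: the star around rho is a spanning
   tree. *)
Definition star_edges : {set {set option V}} :=
  [set [set Some i; None] | i : V]%SET.

Lemma edge_rel_star a b :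
  edge_rel star_edges a b = (isSome a (+) isSome b).
Proof.
apply/imsetP/idP => [[i _ E]|].
  have : None \in [set Some i; None]%SET by rewrite !inE.
  have : Some i \in [set Some i; None]%SET by rewrite !inE eqxx.
  rewrite -E !inE => /orP[] /eqP<- /=; first by case: b {E}.
  by case: a {E}.
case: a b => [i|] [j|] //= _; first by exists i.
by exists j => //; rewrite finset.setUC.
Qed.

Lemma star_is_spanning_tree : is_spanning_tree star_edges.
Proof.
split.
- apply/fintype.subsetP => _ /imsetP[i _ ->]; apply/imsetP.
  by exists (Some i, None); rewrite ?inE.
- have None_conn a : connect (edge_rel star_edges) a None.
    by case: a => [i|]; [apply: connect1; rewrite edge_rel_star|].
  have sym : symmetric (edge_rel star_edges).
    by move=> a b; rewrite !edge_rel_star addbC.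
  move=> a b; apply: connect_trans (None_conn a) _.
  by rewrite (sym_connect_sym sym).
- case=> [|a [|b [|c s]]] //= _ /andP[].
  rewrite /cycle rcons_path /= !edge_rel_star => /andP[/and3P[ab bc cs] sa].
  case: b ab bc => [b|]; case: a sa => [a|] //; case: c cs => [c|] //=.
  move=> _ lasts _ _ /and3P[_ /negP Ns _]; apply: Ns.
  by move: lasts (mem_last (Some c) s); case: (last _ _).
Qed.

Definition star_tree : spanning_tree :=
  exist _ star_edges (asboolT star_is_spanning_tree).

HB.instance Definition _ := isPointed.Build spanning_tree star_tree.
HB.instance Definition _ := @isMeasurable.Build default_measure_display
  spanning_tree discrete_measurable discrete_measurable0
  discrete_measurableC discrete_measurableU.

Definition tree_counting (R : realType) : set spanning_tree -> \bar R :=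
  @counting spanning_tree R.

HB.instance Definition _ (R : realType) := Measure.on (tree_counting R).

Lemma tree_counting_sigma_finite (R : realType) :
  sigma_finite setT (tree_counting R).
Proof.
exists (fun=> setT); first by rewrite bigcup_const.
move=> _; split=> //; rewrite /tree_counting /counting asboolT ?ltry//.
exact: finite_finset.
Qed.

HB.instance Definition _ (R : realType) :=
  @Measure_isSigmaFinite.Build _ _ _ (tree_counting R)
    (@tree_counting_sigma_finite R).

End spanning_trees.

(* R^V is realized by tuples through the enumeration of V. *)
Notation vec R V := (#|V|.-tuple (measurableTypeR R)).
Notation sample_space R V e := (vec R V * vec R V * @spanning_tree V e)%type.

Section model.
Variables (R : realType) (V : finType) (e : rel V).
Variables (beta : V -> V -> R) (eps : V -> R).
Implicit Types (t s : vec R V) (a b : option V) (E : {set option V}).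

(* The vectors t and s extended by t_rho = s_rho = 0. *)
Definition ext_coord t a : R := oapp (fun i => tnth t (enum_rank i)) 0 a.

Definition cosh (r : R) : R := (expR r + expR (- r)) / 2.

Definition B_ t s a b : R :=
  cosh (ext_coord t a - ext_coord t b) +
  2^-1 * (ext_coord s a - ext_coord s b) ^+ 2 * expR (ext_coord t a + ext_coord t b).

Definition ext_weight a b : R :=
  match a, b with
  | Some i, Some j => beta i j
  | Some i, None | None, Some i => eps i
  | None, None => 0
  end.

(* The value of f at the ends of E; it does not depend on the order in which
   the ends are picked when f is symmetric on E, see edge_funE. *)
Definition edge_fun (f : option V -> option V -> R) E : R :=
  if [pick p : option V * option V | E == [set p.1; p.2]%SET] is Some p
  then f p.1 p.2 else 0.

Lemma edge_funE f a b : f a b = f b a ->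
  edge_fun f [set a; b]%SET = f a b.
Proof.
move=> f_sym; rewrite /edge_fun; case: pickP => [[c d] /= /eqP E|/(_ (a, b))].
  have : a \in [set c; d]%SET by rewrite -E !inE eqxx.
  have : b \in [set c; d]%SET by rewrite -E !inE eqxx orbT.
  have : c \in [set a; b]%SET by rewrite E !inE eqxx.
  have : d \in [set a; b]%SET by rewrite E !inE eqxx orbT.
  rewrite !inE => /orP[]/eqP-> /orP[]/eqP->; rewrite ?orbb //.
  - by move=> /eqP->.
  - by move=> _ /eqP->.
by rewrite eqxx.
Qed.

Definition edge_weight t E : R :=
  edge_fun (fun a b => ext_weight a b * expR (ext_coord t a + ext_coord t b)) E.

Definition mu_density (w : sample_space R V e) : R :=
  let: (t, s, T) := w in
  (\prod_(j : V) (expR (- ext_coord t (Some j)) / (2 * pi))) *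
  (\prod_(E in ext_edges e)
     edge_fun (fun a b => expR (- (ext_weight a b * (B_ t s a b - 1)))) E) *
  \prod_(E in tree_edges T) edge_weight t E.

Definition base_measure : set (sample_space R V e) -> \bar R :=
  ((lebesgue_tuple R #|V| \x lebesgue_tuple R #|V|) \x @tree_counting V e R)%E.

Definition mu (D : set (sample_space R V e)) : \bar R :=
  (\int[base_measure]_(w in D) (mu_density w)%:E)%E.

Definition rv_t (w : sample_space R V e) : vec R V := w.1.1.
Definition rv_T (w : sample_space R V e) : spanning_tree e := w.2.

Lemma measurable_rv_t : measurable_fun setT rv_t.
Proof. exact: measurableT_comp. Qed.

Lemma measurable_ext_coord d (T : measurableType d) (f : T -> vec R V) a :
  measurable_fun setT f -> measurable_fun setT (fun w => ext_coord (f w) a).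
Proof.
move=> mf; case: a => [i|] /=; last exact: measurable_cst.
by have /measurable_fun_tnthP/(_ (enum_rank i)) := mf.
Qed.

Lemma measurable_edge_fun d (T : measurableType d)
    (f : T -> option V -> option V -> R) E :
  (forall a b, measurable_fun setT (fun w => f w a b)) ->
  measurable_fun setT (fun w => edge_fun (f w) E).
Proof.
by move=> mf; rewrite /edge_fun; case: pickP => [p _|_] //.
Qed.

Lemma measurable_mu_density : measurable_fun setT mu_density.
Proof.
have mt a : measurable_fun setT (fun w : sample_space R V e => ext_coord (rv_t w) a).
  by apply: measurable_ext_coord; exact: measurable_rv_t.
have ms a : measurable_fun setT (fun w : sample_space R V e => ext_coord w.1.2 a).
  by apply: measurable_ext_coord; exact: measurableT_comp.
rewrite (_ : mu_density = fun w : sample_space R V e =>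
  (\prod_(j <- enum V) (expR (- ext_coord (rv_t w) (Some j)) / (2 * pi))) *
  (\prod_(E <- enum (ext_edges e))
     edge_fun (fun a b => expR (- (ext_weight a b * (B_ (rv_t w) w.1.2 a b - 1)))) E) *
  \prod_(E <- enum [set: {set option V}]%SET) if E \in tree_edges w.2 then edge_weight (rv_t w) E else 1); last first.
  apply/funext => -[[t s] T]; rewrite /mu_density /= !big_enum /=.
  congr (_ * _ * _); rewrite big_mkcond/=; apply: eq_big => // E.
  by rewrite inE.
apply: measurable_funM; first apply: measurable_funM.
- apply: measurable_prod => i _; apply: measurable_funM => //.
  by apply: measurableT_comp => //; exact: measurable_funN.
- apply: measurable_prod => E _; apply: measurable_edge_fun => a b.
  apply: measurableT_comp => //; apply: measurable_funN; apply: measurable_funM => //.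
  apply: measurable_funB => //; apply: measurable_funD.
    apply: measurable_funM => //; apply: measurable_funD.
      by apply: measurableT_comp => //; exact: measurable_funB.
    by apply: measurableT_comp => //; apply: measurable_funN; exact: measurable_funB.
  apply: measurable_funM; last by apply: measurableT_comp => //; exact: measurable_funD.
  by apply: measurable_funM => //; apply: measurable_funX; exact: measurable_funB.
- apply: measurable_prod => E _; apply: measurable_fun_ifT => //=.
    apply: (@measurableT_comp _ _ _ _ _ _ (fun T : spanning_tree e => E \in tree_edges T)) => //.
  apply: measurable_edge_fun => a b; apply: measurable_funM => //.
  by apply: measurableT_comp => //; exact: measurable_funD.
Qed.

Section mu_measure.
Hypothesis e_sym : symmetric e.
Hypothesis beta_ge0 : forall i j, e i j -> 0 <= beta i j.
Hypothesis eps_ge0 : forall i, 0 <= eps i.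

Lemma edge_fun_ge0 (f : option V -> option V -> R) E :
  (forall a b, ext_adj e a b -> 0 <= f a b) ->
  E \in ext_edges e -> 0 <= edge_fun f E.
Proof.
have adj_sym : symmetric (ext_adj e) by case=> [i|] [j|] //=; exact: e_sym.
move=> f_ge0 /imsetP[[a b]]; rewrite inE /= => ab ->.
rewrite /edge_fun; case: pickP => [[c d] /= /eqP E'|//].
apply: f_ge0.
have : a \in [set c; d]%SET by rewrite -E' !inE eqxx.
have : b \in [set c; d]%SET by rewrite -E' !inE eqxx orbT.
have : c \in [set a; b]%SET by rewrite E' !inE eqxx.
have : d \in [set a; b]%SET by rewrite E' !inE eqxx orbT.
rewrite !inE => /orP[]/eqP-> /orP[]/eqP->; rewrite ?orbb //.
- by move=> /eqP ba; move: ab; rewrite ba.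
- by rewrite adj_sym.
- by move=> _ /eqP ab'; move: ab; rewrite ab'.
Qed.

Lemma ext_weight_ge0 a b : ext_adj e a b -> 0 <= ext_weight a b.
Proof. by case: a b => [i|] [j|] //=; exact: beta_ge0. Qed.

Lemma mu_density_ge0 w : 0 <= mu_density w.
Proof.
case: w => -[t s] T; rewrite /mu_density /=; apply: mulr_ge0; first apply: mulr_ge0.
- by apply: prodr_ge0 => j _; rewrite divr_ge0 ?expR_ge0// mulr_ge0// pi_ge0.
- apply: prodr_ge0 => E ET; apply: edge_fun_ge0 => // a b _; exact: expR_ge0.
- have [/fintype.subsetP TE _ _] := asboolW (valP T).
  apply: prodr_ge0 => E /TE ET; apply: edge_fun_ge0 => // a b ab.
  by rewrite mulr_ge0 ?expR_ge0 ?ext_weight_ge0.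
Qed.

Let mu0 : mu set0 = 0%E.
Proof. by rewrite /mu integral_set0. Qed.

Let mu_ge0 D : (0 <= mu D)%E.
Proof. by apply: integral_ge0 => w _; rewrite lee_fin mu_density_ge0. Qed.

Let mu_sigma_additive : semi_sigma_additive mu.
Proof.
apply: (@semi_sigma_additive_nng_induced _ _ _ base_measure).
  by apply/measurable_EFinP; exact: measurable_mu_density.
by move=> w; rewrite lee_fin mu_density_ge0.
Qed.

Definition mu_measure : {measure set (sample_space R V e) -> \bar R} :=
  HB.pack mu (isMeasure.Build _ _ _ mu mu0 mu_ge0 mu_sigma_additive).

End mu_measure.

Definition A_ t (i j : V) : R :=
  if e i j then - beta i j * expR (ext_coord t (Some i) + ext_coord t (Some j))
  else if i == j then
    \sum_(k | e k j) beta k j * expR (ext_coord t (Some k) + ext_coord t (Some j))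
  else 0.

Definition eps_hat t (i j : V) : R :=
  if i == j then eps i * expR (ext_coord t (Some i)) else 0.

Definition mx_of (M : V -> V -> R) : 'M[R]_#|V| :=
  \matrix_(i, j) M (enum_val i) (enum_val j).

Definition green t (x y : V) : R :=
  expR (ext_coord t (Some x) + ext_coord t (Some y)) *
  invmx (mx_of (A_ t) + mx_of (eps_hat t)) (enum_rank x) (enum_rank y).

Definition tree_connected (T : spanning_tree e) (x y : V) : bool :=
  connect (fun i j : V => edge_rel (tree_edges T) (Some i) (Some j)) x y.

End model.

(* K is a regular conditional law of nu (that is, of the identity of Omega)
   given f. *)
Definition is_cond_law d d' (R : realType) (Omega : measurableType d)
    (X : measurableType d') (nu : set Omega -> \bar R) (f : Omega -> X)
    (K : R.-pker X ~> Omega) : Prop :=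
  forall (A : set X) (D : set Omega), measurable A -> measurable D ->
    nu (f @^-1` A `&` D) = (\int[nu]_(w in f @^-1` A) K (f w) D)%E.

(* Main.v *)
Require Import Defs.
From HB Require Import structures.
From mathcomp Require Import all_boot all_order all_algebra.
From mathcomp Require Import all_classical all_reals all_analysis.
From mathcomp Require Import measurable_realfun ring.

Set Implicit Arguments.
Unset Strict Implicit.
Unset Printing Implicit Defensive.

Import Order.TTheory GRing.Theory Num.Theory.
Import numFieldNormedType.Exports.

Local Open Scope classical_set_scope.
Local Open Scope ring_scope.

(** Given [t], the density factorizes into a Gaussian-type factor in [s] and the
weight of the tree [T], so the conditional law of [T] is proportional to the
weight. To make this a regular conditional law, the whole measure is
disintegrated along [t]: the kernel normalizes the mass that the density puts
on the fibre over [t] ([disintegration]). That mass is finite because every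
spin is pinned through a path to [rho]: the square of each [s_v] is at most a
constant times the energy ([spin_le_energy]), so the density in [s] is
dominated by a product of Gaussians.

The formula for the Green function is a form of the matrix-tree theorem,
proved here without determinants. Orient a spanning tree towards [rho]: it
becomes a parent function [f] from [V] to [option V], all of whose orbits reach
[None] ([arborescence]). For a family of conductances [c], let [F(a, x)] be the
sum over the arborescences in which [x] is a child of [rho] and an ancestor of
[a], each weighted by the product of [c v (f v)] over all [v] other than [x].
Exchanging the parent of [v] against a vertex [a] that does not descend from [v]
maps the pair [(f, a)] to [(f[v := a], f v)] and preserves the product of [c v a]
with the weight of [f]; if [a] descends from [v], its contribution to the
Laplacian at [v] vanishes. This shows that the Laplacian with killing at [rho]
maps [F(., x)] to the total tree weight [W] at [x] and to zero elsewhere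
([laplacian_forest_sum]), so its inverse matrix is [F / W]. Multiplying [F(y, x)]
by the conductance between [x] and [rho] restores the missing factor, and gives
the weight of the trees that contain the edge from [x] to [rho] and link [y] to
[x] off [rho]. The inverse is symmetric, and the events for [x] and for [y] are
disjoint because a tree has no cycle; adding the two identities gives the
formula ([green_rooted_link]). *)

(** * Arborescences as parent functions *)

Section arborescences.
Variable V : finType.
Implicit Types (f : {ffun V -> option V}) (u v x : V) (a b : option V).

Definition parent f : option V -> option V := obind f.

Definition reaches f a b : bool := fconnect (parent f) a b.

Definition arborescence f : bool := [forall v, reaches f (Some v) None].

Definition redirect f v a : {ffun V -> option V} :=
  [ffun u => if u == v then a else f u].

Lemma iter_parent_None f n : iter n (parent f) None = None.
Proof. by elim: n => //= n ->. Qed.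

Lemma reachesP f a b :
  reflect (exists n, iter n (parent f) a = b) (reaches f a b).
Proof.
apply: (iffP idP) => [|[n <-]]; last exact: fconnect_iter.
by move=> /iter_findex ab; exists (findex (parent f) a b).
Qed.

Lemma reaches_refl f a : reaches f a a.
Proof. exact: connect0. Qed.

Lemma reaches_trans f a b c : reaches f a b -> reaches f b c -> reaches f a c.
Proof. exact: connect_trans. Qed.

Lemma reaches_step f v b : Some v != b -> reaches f (Some v) b = reaches f (f v) b.
Proof.
move=> vb; apply/reachesP/reachesP => -[n E]; last by exists n.+1; rewrite iterSr.
by case: n E => [/eqP|n]; [rewrite (negbTE vb)|rewrite iterSr; exists n].
Qed.

Lemma reaches_None f v : reaches f None (Some v) = false.
Proof. by apply/reachesP => -[n]; rewrite iter_parent_None. Qed.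

(** Orbits of a function do not branch. *)
Lemma reaches_linear f a b c :
  reaches f a b -> reaches f a c -> reaches f b c || reaches f c b.
Proof.
move=> /reachesP[m <-] /reachesP[n <-].
wlog mn : m n / (m <= n)%N => [H|].
  have [/H //|/ltnW/H] := leqP m n; by rewrite orbC.
by rewrite -(subnK mn) iterD /reaches fconnect_iter.
Qed.

Lemma arborescence_reaches f a : arborescence f -> reaches f a None.
Proof. by case: a => [v /forallP//|_]; exact: reaches_refl. Qed.

(** A vertex on a cycle returns to itself at arbitrarily late times, whereas an
orbit that has reached [None] stays there. *)
Lemma arborescence_acyclic f v : arborescence f -> reaches f (f v) (Some v) = false.
Proof.
move=> /forallP/(_ v)/reachesP[m rv]; apply/reachesP => -[n].
rewrite -[f v]/(parent f (Some v)) -iterSr => loop.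
have loops k : iter (k * n.+1) (parent f) (Some v) = Some v.
  by elim: k => // k IHk; rewrite mulSn iterD IHk.
have := loops m; rewrite -(subnK (leq_pmulr m (ltn0Sn n))) iterD rv.
by rewrite iter_parent_None.
Qed.

(** An orbit that avoids [v] does not see the parent of [v]. *)
Lemma reaches_redirect f v a b c : ~~ reaches f b (Some v) ->
  reaches (redirect f v a) b c = reaches f b c.
Proof.
move=> bv; suff E n : iter n (parent (redirect f v a)) b = iter n (parent f) b.
  by apply/reachesP/reachesP => -[n]; [rewrite E|rewrite -E]; exists n.
elim: n => //= n ->; case E : (iter n _ _) => [u|] //=; rewrite ffunE.
by case: eqP E => // -> E; move: bv; rewrite -E /reaches fconnect_iter.
Qed.

(** Up to its first visit to [v], an orbit does not see the parent of [v]. *)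
Lemma reaches_redirect_self f v a b :
  reaches f b (Some v) -> reaches (redirect f v a) b (Some v).
Proof.
move=> /reachesP[n]; elim: n b => [b /= ->|n IHn b]; first exact: reaches_refl.
have [->|bv] := eqVneq b (Some v); first by rewrite reaches_refl.
rewrite iterSr => /IHn; case: b bv => [u uv|//].
by rewrite (@reaches_step (redirect f v a) u)// ffunE -(inj_eq Some_inj) (negbTE uv).
Qed.

Lemma arborescence_redirect f v a : arborescence f -> ~~ reaches f a (Some v) ->
  arborescence (redirect f v a).
Proof.
move=> Af av; apply/forallP => u.
have aN : reaches (redirect f v a) a None.
  by rewrite reaches_redirect// arborescence_reaches.
have [uv|uv] := boolP (reaches f (Some u) (Some v)).
  apply: reaches_trans (reaches_redirect_self a uv) _.
  by rewrite reaches_step// ffunE eqxx.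
by rewrite reaches_redirect// arborescence_reaches.
Qed.

Lemma redirect_at f v a : redirect f v a v = a.
Proof. by rewrite ffunE eqxx. Qed.

Lemma redirect_redirect f v a b : redirect (redirect f v a) v b = redirect f v b.
Proof. by apply/ffunP => u; rewrite !ffunE; case: eqP. Qed.

Lemma redirect_id f v : redirect f v (f v) = f.
Proof. by apply/ffunP => u; rewrite ffunE; case: eqP => // ->. Qed.

(** The domain of the exchange of parents: the pairs [(f, a)] such that [a] is not
a descendant of [v] are mapped to pairs of the same kind. *)
Lemma redirect_swap f v a : arborescence f -> ~~ reaches f a (Some v) ->
  arborescence (redirect f v a) /\ ~~ reaches (redirect f v a) (f v) (Some v).
Proof.
move=> Af av; split; first exact: arborescence_redirect.
by rewrite reaches_redirect arborescence_acyclic.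
Qed.

(** * A matrix-tree theorem by exchange of parents *)

Section matrix_tree.
Variables (R : comPzRingType) (c : V -> option V -> R).

Definition arb_weight f : R := \prod_v c v (f v).

(** Dropping the edge from the root vertex [x] to [None] leaves a forest with two
components, one of them containing [None]; this is its weight. *)
Definition forest_weight x f : R := \prod_(v | v != x) c v (f v).

Definition tree_sum : R := \sum_(f | arborescence f) arb_weight f.

Definition forest_sum a x : R :=
  \sum_(f | arborescence f && (f x == None)) forest_weight x f *+ reaches f a (Some x).

Lemma forest_sum_None x : forest_sum None x = 0.
Proof. by apply: big1 => f _; rewrite reaches_None. Qed.

Lemma arb_weight_forest x f : arb_weight f = c x (f x) * forest_weight x f.
Proof. by rewrite /arb_weight (bigD1 x). Qed.

(** The weights of [(f, a)] and of its image under the exchange of parents both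
are the product of [c v a], [c v (f v)] and the factors of the other vertices. *)
Lemma forest_weight_redirect x v f a : v != x ->
  c v a * forest_weight x f = c v (f v) * forest_weight x (redirect f v a).
Proof.
move=> vx; rewrite /forest_weight (bigD1 v)//= [in RHS](bigD1 v)//= redirect_at.
rewrite mulrCA; do 2!congr (_ * _).
by apply: eq_bigr => u /andP[_ /negbTE uv]; rewrite ffunE uv.
Qed.

Lemma forest_sum_diff v x :
  \sum_a c v a * (forest_sum (Some v) x - forest_sum a x) =
  \sum_(p : {ffun V -> option V} * option V | arborescence p.1 && (p.1 x == None))
     c v p.2 * forest_weight x p.1 *
     ((reaches p.1 (Some v) (Some x))%:R - (reaches p.1 p.2 (Some x))%:R).
Proof.
transitivity (\sum_(f | arborescence f && (f x == None)) \sum_a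
    c v a * forest_weight x f *
    ((reaches f (Some v) (Some x))%:R - (reaches f a (Some x))%:R)); last first.
  by rewrite pair_big_dep; apply: eq_bigl => p; rewrite andbT.
rewrite exchange_big; apply: eq_bigr => a _ /=.
rewrite /forest_sum -sumrB mulr_sumr; apply: eq_bigr => f _.
by rewrite -!(mulr_natr (forest_weight _ _)) -mulrBr mulrA.
Qed.

(** The terms in which [a] descends from [x] cancel. In the others, [x] is a child
of [None] and gets redirected to [a]; this produces each arborescence exactly
once, the inverse map being to redirect [x] back to [None]. *)
Lemma forest_sum_root x :
  \sum_a c x a * (forest_sum (Some x) x - forest_sum a x) = tree_sum.
Proof.
rewrite forest_sum_diff /tree_sum.
rewrite (reindex_onto (fun p : {ffun V -> option V} * option V => redirect p.1 x p.2)
  (fun f => (redirect f x None, f x)))/=; last first.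
  by move=> f _; rewrite redirect_redirect redirect_id.
rewrite (bigID (fun p => reaches p.1 p.2 (Some x)))/= big1 ?add0r; last first.
  by move=> -[f a] /= /andP[_ ->]; rewrite reaches_refl subrr mulr0.
apply: eq_big => -[f a] /=.
  rewrite redirect_redirect redirect_at.
  have -> : ((redirect f x None, a) == (f, a)) = (f x == None).
    apply/eqP/eqP => [[<-]|fx]; first by rewrite redirect_at.
    by rewrite -[in LHS]fx redirect_id.
  have [fx|_] := eqVneq (f x) None; rewrite ?andbF// !andbT.
  apply/andP/idP => [[Af ax]|Af']; first exact: arborescence_redirect.
  have [] := @redirect_swap _ x None Af'; first by rewrite reaches_None.
  have fE : redirect f x None = f by rewrite -[in LHS]fx redirect_id.
  by rewrite redirect_redirect redirect_at fE.
move=> /andP[_ /negbTE ->]; rewrite reaches_refl subr0 mulr1.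
rewrite (arb_weight_forest x) redirect_at; congr (_ * _).
by apply: eq_bigr => u /negbTE ux; rewrite ffunE ux.
Qed.

(** If [a] descends from [v], then [a] and [v] have the same ancestors among the
children of [None] and the term vanishes. On the other pairs the exchange of
parents is a weight-preserving involution, and [v] descends from [x] in the
image of [(f, a)] exactly if [a] descends from [x] in [f]; so the two halves of
the difference have the same sum. *)
Lemma forest_sum_harmonic v x : v != x ->
  \sum_a c v a * (forest_sum (Some v) x - forest_sum a x) = 0.
Proof.
move=> vx; rewrite forest_sum_diff.
rewrite (bigID (fun p => reaches p.1 p.2 (Some v)))/= big1 ?add0r; last first.
  move=> -[f a] /= /andP[/andP[_ /eqP fx] av].
  (* [v] cannot be a proper ancestor of [x], whose parent is [None]. *)
  suff -> : reaches f (Some v) (Some x) = reaches f a (Some x).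
    by rewrite subrr mulr0.
  apply/idP/idP => [|ax]; first exact: reaches_trans.
  have := reaches_linear av ax.
  by rewrite [X in _ || X]reaches_step 1?eq_sym// fx reaches_None orbF.
under eq_bigr do rewrite mulrBr.
apply/eqP; rewrite sumrB subr_eq0; apply/eqP.
pose swap (p : {ffun V -> option V} * option V) := (redirect p.1 v p.2, p.1 v).
have swapK : involutive swap.
  by case=> f a; rewrite /swap/= redirect_redirect redirect_id redirect_at.
rewrite (reindex_inj (inv_inj swapK))/=.
have swap_dom f a :
    [&& arborescence f && (f x == None) & ~~ reaches f a (Some v)] ->
    [&& arborescence (redirect f v a) && (redirect f v a x == None)
      & ~~ reaches (redirect f v a) (f v) (Some v)].
  move=> /andP[/andP[Af fx] av]; have [-> ->] := redirect_swap Af av.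
  by rewrite ffunE [x == v]eq_sym (negbTE vx) fx.
apply: eq_big => -[f a] /=.
  apply/idP/idP => [|/swap_dom//].
  by move=> /swap_dom; rewrite redirect_redirect redirect_id redirect_at.
move=> /swap_dom; rewrite redirect_redirect redirect_id redirect_at.
move=> /andP[_ av].
rewrite -forest_weight_redirect//; congr (_ * _%:R).
rewrite reaches_step ?redirect_at//.
by rewrite reaches_redirect.
Qed.

Theorem laplacian_forest_sum v x :
  \sum_a c v a * (forest_sum (Some v) x - forest_sum a x) =
  tree_sum *+ (v == x).
Proof.
by have [<-|vx] := eqVneq v x; [exact: forest_sum_root|exact: forest_sum_harmonic].
Qed.

End matrix_tree.
End arborescences.

(** * Spanning trees and arborescences *)

Section shortest_paths.
Variables (V : finType) (r : rel (option V)).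

(** Take as parent of [v] the next vertex on a shortest path from [v] to [None]:
distances decrease along orbits, so all orbits end in [None]. *)
Lemma arborescence_in_connected : (forall v, connect r (Some v) None) ->
  exists2 f : {ffun V -> option V}, arborescence f & forall v, r (Some v) (f v).
Proof.
move=> r_conn.
pose Q a n := exists p, [/\ path r a p, last a p = None & size p = n].
have closer v : exists b, r (Some v) b /\
    forall n, Q (Some v) n -> exists2 m, (m < n)%N & Q b m.
  have /connectP[p0 rp0 lastp0] := r_conn v.
  have Qv : exists n, `[< Q (Some v) n >].
    by exists (size p0); apply/asboolP; exists p0.
  case: (ex_minnP Qv) => n /asboolP[[|b p] [//= /andP[vb rp] lastp pn]] n_min.
  exists b; split => // m Qm; exists (size p); last by exists p.
  by rewrite pn; apply: n_min; exact/asboolP.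
have [f fP] := choice closer.
exists [ffun v => f v]; last by move=> v; rewrite ffunE; have [] := fP v.
suff H n a : Q a n -> reaches [ffun v => f v] a None.
  apply/forallP => v; have /connectP[p rp lastp] := r_conn v.
  by apply: (H (size p)); exists p.
elim/ltn_ind: n a => n IHn [v|_]; last exact: reaches_refl.
have [_ closer_v] := fP v; move=> /closer_v[m mn Qm].
by rewrite reaches_step// ffunE; exact: IHn Qm.
Qed.

End shortest_paths.

Section tree_bijection.
Variables (V : finType) (e : rel V).
Hypotheses (e_sym : symmetric e) (e_irr : irreflexive e).
Implicit Types (f g : {ffun V -> option V}) (u v x : V) (a b : option V).

Definition arb_edges f : {set {set option V}} := [set [set Some v; f v] | v : V]%SET.

Definition respects f : bool := [forall v, ext_adj e (Some v) (f v)].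

Lemma set2_inj (T : finType) (a b c d : T) : [set a; b]%SET = [set c; d]%SET ->
  (a = c /\ b = d) \/ (a = d /\ b = c).
Proof.
move=> E; have : a \in [set c; d]%SET by rewrite -E !inE eqxx.
have : b \in [set c; d]%SET by rewrite -E !inE eqxx orbT.
have : c \in [set a; b]%SET by rewrite E !inE eqxx.
have : d \in [set a; b]%SET by rewrite E !inE eqxx orbT.
rewrite !inE => /orP[]/eqP ? /orP[]/eqP ? /orP[]/eqP ? /orP[]/eqP ?; subst; tauto.
Qed.

Lemma edge_rel_sym (T : {set {set option V}}) : symmetric (edge_rel T).
Proof. by move=> a b; rewrite /edge_rel finset.setUC. Qed.

Lemma edge_rel_arb f a b : edge_rel (arb_edges f) a b =
  ((a != None) && (b == parent f a)) || ((b != None) && (a == parent f b)).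
Proof.
apply/imsetP/orP => [[v _ /set2_inj[] [-> ->]]|]; rewrite ?eqxx; [by left|by right|].
case=> /andP[]; first by case: a => // v _ /eqP ->; exists v.
by case: b => // v _ /eqP ->; exists v => //; rewrite finset.setUC.
Qed.

Lemma arb_edges_parent f v : edge_rel (arb_edges f) (Some v) (f v).
Proof. by rewrite edge_rel_arb eqxx. Qed.

Definition depth f a : nat := findex (parent f) a None.

Lemma depth_parent f v : arborescence f -> depth f (Some v) = (depth f (f v)).+1.
Proof. by move=> /forallP/(_ v) ?; rewrite /depth fconnect_findex. Qed.

Lemma arb_edge_deeper f a b : arborescence f -> edge_rel (arb_edges f) a b ->
  (depth f b <= depth f a)%N -> b = parent f a.
Proof.
move=> Af; rewrite edge_rel_arb => /orP[/andP[_ /eqP//]|].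
case: b => //= v /eqP ->; by rewrite depth_parent// ltnn.
Qed.

Lemma arb_edges_connected f a b : arborescence f -> connect (edge_rel (arb_edges f)) a b.
Proof.
move=> Af; have toN c : connect (edge_rel (arb_edges f)) c None.
  have /reachesP[n] := arborescence_reaches c Af.
  elim: n c => [c /= ->|n IHn [v|]]; [exact: connect0| |by rewrite connect0].
  by rewrite iterSr => /IHn; apply: connect_trans; exact/connect1/arb_edges_parent.
apply: connect_trans (toN a) _.
by rewrite (sym_connect_sym (@edge_rel_sym _)).
Qed.

(** A vertex of maximal depth on a cycle would have its parent as both of its
neighbours. *)
Lemma arb_edges_acyclic f : arborescence f -> acyclic_edges (arb_edges f).
Proof.
move=> Af c c_gt2 Cc.
have [a0 a0c] : exists a0, a0 \in c by case: c c_gt2 {Cc} => // a0 c _; exists a0; rewrite inE eqxx.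
have [a ac a_max] := arg_maxnP (depth f) a0c.
have [i c' cE] := rot_to ac.
have : ucycle (edge_rel (arb_edges f)) (rot i c) by rewrite rot_ucycle.
have : (2 < size (rot i c))%N by rewrite size_rot.
have deep b : b \in rot i c -> (depth f b <= depth f a)%N.
  by rewrite mem_rot; exact: a_max.
rewrite cE in deep * => {cE}.
case: c' deep => [|b [|d c']] //= deep _.
rewrite /ucycle /= rcons_path/= => /andP[/and3P[ab _ /andP[_ za]] /and3P[_ bd _]].
have bE : b = parent f a.
  by apply: arb_edge_deeper ab (deep _ _); rewrite // !inE eqxx orbT.
have zE : last d c' = parent f a.
  apply: arb_edge_deeper => //; first by rewrite edge_rel_sym.
  by apply: deep; rewrite 2!in_cons mem_last !orbT.
by move: bd; rewrite bE -zE mem_last.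
Qed.

Lemma arb_spanning_tree f : arborescence f -> respects f ->
  is_spanning_tree e (arb_edges f).
Proof.
move=> Af rf; split; [|by move=> a b; exact: arb_edges_connected|exact: arb_edges_acyclic].
apply/fintype.subsetP => _ /imsetP[v _ ->]; apply/imsetP.
by exists (Some v, f v); rewrite ?inE //=; exact: (forallP rf).
Qed.

(** By induction on the depth of [v] in [f]. If the edge from [v] to [f v] were
oriented the other way in [g], the parent of [v] in [f] would have [v] as parent
in [g], hence in [f], and [f] would have a cycle. *)
Lemma arb_edges_inj f g : arborescence f -> arborescence g ->
  arb_edges f = arb_edges g -> f = g.
Proof.
move=> Af Ag fg.
have H n v : depth f (Some v) = n -> f v = g v.
  elim/ltn_ind: n v => n IHn v dv.
  have := arb_edges_parent f v; rewrite fg edge_rel_arb /= => /orP[/eqP//|].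
  case E : (f v) => [u|] //= /eqP vu.
  have du : depth f (Some v) = (depth f (Some u)).+1 by rewrite depth_parent// E.
  have fu : f u = g u by apply: (IHn (depth f (Some u))) => //; rewrite -dv du.
  by have := depth_parent u Af; rewrite fu -vu du => /eqP; rewrite -addn2 -[X in X == _]addn0 eqn_add2l.
by apply/ffunP => v; exact: H.
Qed.

Lemma ext_adj_sym : symmetric (ext_adj e).
Proof. by case=> [u|] [v|] //=; exact: e_sym. Qed.

Lemma ext_edge_neq a b : ext_adj e a b -> a != b.
Proof.
case: a b => [u|] [v|] //= uv; apply: contraTneq uv => -[->]; by rewrite e_irr.
Qed.

(** The shortest-path arborescence uses only edges of [T] and already connects all
vertices, so any further edge of [T] would close a cycle. *)
Lemma spanning_tree_arb T : is_spanning_tree e T ->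
  exists2 f, arborescence f && respects f & arb_edges f = T.
Proof.
move=> [Te Tconn Tacyc].
have [f Af fT] := @arborescence_in_connected V (edge_rel T) (fun v => Tconn (Some v) None).
have sub : arb_edges f \subset T.
  by apply/fintype.subsetP => _ /imsetP[v _ ->]; exact: fT.
have adj a b : edge_rel T a b -> ext_adj e a b.
  move=> /(fintype.subsetP Te)/imsetP[[c d]]; rewrite inE/= => cd.
  by case/set2_inj => [] [-> ->]; rewrite // ext_adj_sym.
exists f; first by rewrite Af; apply/forallP => v; exact/adj/fT.
apply/eqP; rewrite finset.eqEsubset sub; apply/fintype.subsetP => E ET.
have /imsetP[[a b] _ /= EE] := fintype.subsetP Te _ ET; rewrite EE in ET *.
apply: contraT => /negP not_ab; exfalso.
have /connectP[p pP blast] := arb_edges_connected a b Af.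
case/shortenP: pP blast => {}p pP p_uniq _ blast.
have pT : path (edge_rel T) a p.
  by apply: sub_path pP => c d; exact: (fintype.subsetP sub).
have ab := ext_edge_neq (adj a b ET).
apply: (Tacyc (a :: p)); last first.
  by rewrite /ucycle p_uniq andbT /= rcons_path pT -blast edge_rel_sym; exact: ET.
case: p pP {p_uniq pT} blast => [_ /= ba|c [|//] /=]; first by rewrite ba eqxx in ab.
by rewrite andbT => ac bc; case: not_ab; rewrite bc.
Qed.

Variables (R : comPzSemiRingType).

(** Distinct vertices have distinct parent edges, since two vertices cannot be the
parents of each other. *)
Lemma prod_arb_edges f (w : {set option V} -> R) : arborescence f ->
  \prod_(E in arb_edges f) w E = \prod_v w [set Some v; f v]%SET.
Proof.
move=> Af; rewrite /arb_edges big_imset//= => u v _ _ /set2_inj[[[]]//|[uv vu]].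
have [//|neq_uv] := eqVneq u v.
have := arborescence_acyclic u Af.
by rewrite vu reaches_step -?uv ?reaches_refl// (inj_eq Some_inj) eq_sym.
Qed.

Lemma sum_spanning_trees (F : {set {set option V}} -> R) :
  \sum_(S : spanning_tree e) F (tree_edges S) =
  \sum_(f | arborescence f && respects f) F (arb_edges f).
Proof.
pose tree f : spanning_tree e := insubd (star_tree e) (arb_edges f).
have treeE f : arborescence f && respects f -> tree_edges (tree f) = arb_edges f.
  by move=> /andP[Af rf]; rewrite /tree_edges insubdK//; apply/asboolP/arb_spanning_tree.
transitivity (\sum_(S in [set tree f | f in [set f | arborescence f && respects f]]%SET)
  F (tree_edges S)).
  apply: eq_bigl => S; apply/esym/imsetP.
  have [f fP fS] := spanning_tree_arb (asboolW (valP S)).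
  exists f; first by rewrite inE.
  by apply: val_inj; rewrite -[RHS]/(tree_edges (tree f)) treeE.
rewrite big_imset/=; last first.
  move=> f g; rewrite !inE => fP gP /(congr1 (@tree_edges _ _)).
  rewrite !treeE//; move: fP gP => /andP[Af _] /andP[Ag _]; exact: arb_edges_inj.
by apply: eq_big => f; rewrite inE// => /treeE ->.
Qed.

Lemma root_edge_arb f x : arborescence f ->
  edge_rel (arb_edges f) (Some x) None = (f x == None).
Proof. by move=> Af; rewrite edge_rel_arb/= orbF eq_sym. Qed.

(** An edge that avoids [None] joins a vertex to its parent, so being a descendant
of [x] propagates along paths that avoid [None]; conversely the orbit of a
descendant of [x] up to [x] is such a path. *)
Lemma connect_arb f x y : f x = None -> arborescence f ->
  connect (fun i j => edge_rel (arb_edges f) (Some i) (Some j)) x y =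
  reaches f (Some y) (Some x).
Proof.
move=> fx Af; apply/idP/idP.
  move=> /connectP[p]; elim/last_ind: p y => [y _ ->|p z IHp y].
    exact: reaches_refl.
  rewrite rcons_path last_rcons => /andP[/IHp/(_ erefl) IH edge] ->.
  move: edge; rewrite edge_rel_arb /= => /orP[] /eqP E; last first.
    by apply: reaches_trans IH; rewrite E; exact: fconnect1 (parent f) (Some z).
  have [lx|lx] := eqVneq (last x p) x; first by rewrite lx fx in E.
  by move: IH; rewrite reaches_step// -E.
move=> /reachesP[n]; elim: n y => [y [->]|n IHn y]; first exact: connect0.
rewrite iterSr /=; case fy : (f y) => [z|]; last by rewrite iter_parent_None.
move=> /IHn xz; apply: connect_trans xz (connect1 _).
by rewrite edge_rel_arb /= fy eqxx orbT.
Qed.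

End tree_bijection.

(** * The Green function *)

Section positive_tree_sum.
Variables (V : finType) (R : realDomainType) (c : V -> option V -> R).

Lemma tree_sum_gt0 :
  (forall v a, 0 <= c v a) ->
  (forall v, connect (fun a b => if a is Some u then 0 < c u b else false)
    (Some v) None) ->
  0 < tree_sum c.
Proof.
move=> c_ge0 c_conn; have [f Af fP] := arborescence_in_connected c_conn.
rewrite /tree_sum (bigD1 f)//= ltr_wpDr//; last exact: prodr_gt0.
by apply: sumr_ge0 => g _; exact: prodr_ge0.
Qed.

End positive_tree_sum.

(** The factor of the edge from [x] to [None], which the forest weight omits, is
restored. *)
Lemma root_forest_sum (V : finType) (R : comPzRingType) (c : V -> option V -> R) a x :
  c x None * forest_sum c a x =
  \sum_(f | arborescence f) arb_weight c f *+ ((f x == None) && reaches f a (Some x)).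
Proof.
rewrite /forest_sum mulr_sumr [RHS](bigID (fun f : {ffun V -> option V} => f x == None))/=.
rewrite [X in _ = _ + X]big1 ?addr0; last by move=> f /andP[_ /negbTE ->].
apply: eq_bigr => f /andP[_ /eqP fx].
by rewrite fx eqxx (arb_weight_forest c x) fx mulrnAr.
Qed.

Lemma big_option (T : finType) (R : Type) (idx : R) (op : Monoid.com_law idx)
    (F : option T -> R) :
  \big[op/idx]_a F a = op (F None) (\big[op/idx]_v F (Some v)).
Proof.
rewrite (bigD1 None)//=; congr (op _ _).
rewrite (reindex_omap Some id)/=; last by case.
by apply: eq_bigl => v; rewrite eqxx.
Qed.

Section green_function.
Variables (R : realType) (V : finType) (e : rel V).
Hypotheses (e_sym : symmetric e) (e_irr : irreflexive e).
Hypothesis e_conn : forall i j, connect e i j.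
Variable beta : V -> V -> R.
Hypothesis beta_sym : forall i j, e i j -> beta i j = beta j i.
Hypothesis beta_gt0 : forall i j, e i j -> 0 < beta i j.
Variable eps : V -> R.
Hypothesis eps_ge0 : forall i, 0 <= eps i.
Variable root : V.
Hypothesis eps_root : 0 < eps root.
Implicit Types t : vec R V.

(** Zero off the edges, so that sums over all parent functions reduce to those that
come from spanning trees. *)
Definition conductance t v a : R :=
  if ext_adj e (Some v) a
  then ext_weight beta eps (Some v) a * expR (ext_coord t (Some v) + ext_coord t a)
  else 0.

Definition tree_weight t (T : {set {set option V}}) : R :=
  \prod_(E in T) edge_weight beta eps t E.

Lemma edge_weight_conductance t v a : ext_adj e (Some v) a ->
  edge_weight beta eps t [set Some v; a]%SET = conductance t v a.
Proof.
move=> va; rewrite /edge_weight edge_funE /conductance ?va// [X in expR X]addrC.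
by congr (_ * _); case: a va => //= u; exact: beta_sym.
Qed.

Lemma tree_weight_arb t f : arborescence f -> respects e f ->
  tree_weight t (arb_edges f) = arb_weight (conductance t) f.
Proof.
move=> Af /forallP rf; rewrite /tree_weight prod_arb_edges//.
by apply: eq_bigr => v _; exact: edge_weight_conductance.
Qed.

Lemma sum_tree_weight t (P : pred {set {set option V}}) :
  \sum_(S : spanning_tree e) tree_weight t (tree_edges S) *+ P (tree_edges S) =
  \sum_(f | arborescence f) arb_weight (conductance t) f *+ P (arb_edges f).
Proof.
rewrite (sum_spanning_trees e_sym e_irr (fun T => tree_weight t T *+ P T)).
rewrite [RHS](bigID (respects e))/= [X in _ = _ + X]big1 ?addr0.
  by apply: eq_bigr => f /andP[Af rf]; rewrite tree_weight_arb.
move=> f /andP[_ /forallPn[v vf]].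
by rewrite (arb_weight_forest _ v) /conductance (negbTE vf) mul0r mul0rn.
Qed.

Lemma conductance_ge0 t v a : 0 <= conductance t v a.
Proof.
rewrite /conductance; case: ifP => // va; rewrite mulr_ge0 ?expR_ge0//.
by apply: ext_weight_ge0 va => // i j /beta_gt0/ltW.
Qed.

(** Through [root] every vertex is joined to [None] by edges of positive
conductance, so some arborescence has positive weight. *)
Lemma conductance_tree_sum_gt0 t : 0 < tree_sum (conductance t).
Proof.
apply: tree_sum_gt0 => [v a|v]; first exact: conductance_ge0.
set r := (X in connect X).
have to_root u : connect r (Some u) (Some root).
  have /connectP[p] := e_conn u root.
  elim: p u => [u _ ->|w p IHp u /= /andP[uw ep] proot]; first exact: connect0.
  apply: connect_trans (IHp _ ep proot); apply: connect1.
  by rewrite /r /conductance /= uw mulr_gt0 ?expR_gt0 ?beta_gt0.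
apply: connect_trans (to_root v) (connect1 _).
by rewrite /r /conductance /= mulr_gt0 ?expR_gt0.
Qed.

Definition pinned_laplacian t : 'M[R]_#|V| :=
  mx_of (A_ e beta t) + mx_of (eps_hat eps t).

Lemma pinned_laplacianE t i j : let v := enum_val i in
  pinned_laplacian t i j =
  (\sum_a conductance t v a) *+ (i == j) - conductance t v (Some (enum_val j)).
Proof.
move=> v; rewrite !mxE /A_ /eps_hat /conductance /= -/v.
rewrite -(inj_eq enum_val_inj) -/v; set u := enum_val j.
have [<-|vu] := eqVneq v u; last first.
  by case: ifP => _; rewrite ?addr0 ?mulNr ?sub0r ?subr0 ?oppr0.
rewrite e_irr big_option /= subr0 addr0 mulr1n addrC; congr (_ + _).
rewrite big_mkcond; apply: eq_bigr => k _; rewrite (e_sym k).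
by case: ifP => // vk; rewrite (beta_sym vk) [X in expR X]addrC.
Qed.

Lemma pinned_laplacian_sym t : (pinned_laplacian t)^T = pinned_laplacian t.
Proof.
apply/matrixP => i j; rewrite mxE !pinned_laplacianE [j == i]eq_sym.
have [->//|_] := eqVneq i j; congr (_ - _); rewrite /conductance /= e_sym.
by case: ifP => // ij; rewrite (beta_sym ij) [X in expR X]addrC.
Qed.

(** The matrix-tree identity says that the Laplacian times the matrix of forest
sums is the total tree weight times the identity. *)
Lemma inv_pinned_laplacian t v x :
  invmx (pinned_laplacian t) (enum_rank v) (enum_rank x) =
  forest_sum (conductance t) (Some v) x / tree_sum (conductance t).
Proof.
set W := tree_sum _; have W0 : W != 0 by rewrite gt_eqF// conductance_tree_sum_gt0.
pose M : 'M[R]_#|V| :=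
  \matrix_(i, j) (forest_sum (conductance t) (Some (enum_val i)) (enum_val j) / W).
have LM : pinned_laplacian t *m M = 1%:M.
  apply/matrixP => i j; rewrite !mxE.
  apply: (mulIf W0); rewrite mulr_suml mulr_natl -(inj_eq enum_val_inj).
  rewrite -(laplacian_forest_sum (conductance t)).
  under [LHS]eq_bigr => k _ do
    rewrite [M _ _]mxE mulrA divfK// pinned_laplacianE mulrBl.
  rewrite sumrB (bigD1 i)//= [X in _ + X - _]big1 ?addr0; last first.
    by move=> k /negbTE ki; rewrite eq_sym ki mul0r.
  under [RHS]eq_bigr do rewrite mulrBr.
  rewrite sumrB eqxx mulr_suml; congr (_ - _).
  rewrite big_option /= forest_sum_None mulr0 add0r.
  by rewrite [RHS](reindex (@enum_val V V))//; exact/onW_bij/enum_val_bij.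
have [unitL _] := mulmx1_unit LM.
by rewrite -[invmx _]mulmx1 -LM mulKmx// mxE !enum_rankK.
Qed.

Lemma forest_sum_sym t x y :
  forest_sum (conductance t) (Some x) y = forest_sum (conductance t) (Some y) x.
Proof.
have W0 : tree_sum (conductance t) != 0 by rewrite gt_eqF// conductance_tree_sum_gt0.
apply: (mulIf (invr_neq0 W0)); rewrite -!inv_pinned_laplacian.
by rewrite -[in LHS]pinned_laplacian_sym -trmx_inv mxE.
Qed.

Definition rooted_link x y (T : {set {set option V}}) : bool :=
  let linked := connect (fun i j => edge_rel T (Some i) (Some j)) x y in
  (edge_rel T (Some x) None && linked) || (edge_rel T (Some y) None && linked).

(** If [x] and [y] both are children of [None], neither descends from the other:
this makes the two events exclusive, and allows the disjunction to be replaced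
by an exclusive one. *)
Lemma rooted_link_arb x y f : x != y -> arborescence f ->
  rooted_link x y (arb_edges f) =
    ((f x == None) && reaches f (Some y) (Some x)) (+)
    ((f y == None) && reaches f (Some x) (Some y)).
Proof.
move=> xy Af; rewrite /rooted_link !root_edge_arb//.
have csym := sym_connect_sym (fun i j => edge_rel_sym (arb_edges f) (Some i) (Some j)).
have [fx|_] := eqVneq (f x) None; have [fy|_] := eqVneq (f y) None => //=.
- rewrite connect_arb// !orbb.
  by rewrite !reaches_step ?fx ?fy ?reaches_None// (inj_eq Some_inj)// eq_sym.
- by rewrite connect_arb// orbF addbF.
- by rewrite csym connect_arb.
Qed.

Lemma green_rooted_link t x y : x != y -> 0 < eps x -> 0 < eps y ->
  green e beta eps t x y =
  expR (ext_coord t (Some x) + ext_coord t (Some y)) /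
  (eps x * expR (ext_coord t (Some x)) + eps y * expR (ext_coord t (Some y))) *
  ((\sum_(S : spanning_tree e)
      tree_weight t (tree_edges S) *+ rooted_link x y (tree_edges S)) /
   \sum_(S : spanning_tree e) tree_weight t (tree_edges S)).
Proof.
move=> xy ex ey; rewrite sum_tree_weight.
have -> : \sum_(S : spanning_tree e) tree_weight t (tree_edges S) =
    tree_sum (conductance t).
  exact: (sum_tree_weight t predT).
under eq_bigr => f Af do rewrite rooted_link_arb//.
have -> : \sum_(f | arborescence f) arb_weight (conductance t) f *+
      (((f x == None) && reaches f (Some y) (Some x)) (+)
       ((f y == None) && reaches f (Some x) (Some y))) =
    (conductance t x None + conductance t y None) *
    forest_sum (conductance t) (Some x) y.
  rewrite mulrDl root_forest_sum forest_sum_sym root_forest_sum -big_split/=.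
  apply: eq_bigr => f Af; rewrite -mulrnDr; congr (_ *+ _).
  have [fx|_] := eqVneq (f x) None; have [fy|_] := eqVneq (f y) None; rewrite //= ?addbF ?addn0//.
  by rewrite !reaches_step ?fx ?fy ?reaches_None// (inj_eq Some_inj)// eq_sym.
rewrite /green -/(pinned_laplacian t) inv_pinned_laplacian /conductance /= !addr0.
rewrite -[RHS]mulrA; congr (_ * _); rewrite -mulrA mulKf//.
by rewrite gt_eqF// addr_gt0// mulr_gt0 ?expR_gt0.
Qed.

End green_function.

(** * Disintegration of a density over a triple product *)

Section density.
Local Open Scope ereal_scope.
Import HBNNSimple.
Context d (T : measurableType d) (R : realType).
Variables (m nu : {measure set T -> \bar R}) (f : T -> R).
Hypotheses (mf : measurable_fun setT f) (f_ge0 : forall x, (0 <= f x)%R).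
Hypothesis nuE : forall D, measurable D -> nu D = \int[m]_(x in D) (f x)%:E.

(** Both sides agree on indicators, hence on simple functions, hence on increasing
limits of them. *)
Lemma ge0_integral_density (h : T -> \bar R) :
  measurable_fun setT h -> (forall x, 0 <= h x) ->
  \int[nu]_x h x = \int[m]_x (h x * (f x)%:E).
Proof.
move=> mh h_ge0; have mfE : measurable_fun setT (EFin \o f) by exact/measurable_EFinP.
have indicE A : measurable A ->
    \int[nu]_x (\1_A x)%:E = \int[m]_x ((\1_A x)%:E * (f x)%:E).
  move=> mA; rewrite integral_indic// setIT nuE// integral_mkcond.
  by apply: eq_integral => x _; rewrite epatch_indic muleC.
have simpleE (g : {nnsfun T >-> R}) :
    \int[nu]_x (g x)%:E = \int[m]_x ((g x)%:E * (f x)%:E).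
  have mterm r : measurable_fun setT (fun x => (r * \1_(g @^-1` [set r]) x)%:E).
    by apply/measurable_EFinP; exact: measurable_funM.
  transitivity (\int[nu]_x \sum_(r \in range g) (r * \1_(g @^-1` [set r]) x)%:E).
    by apply: eq_integral => x _; rewrite fimfunE -fsumEFin.
  transitivity (\int[m]_x \sum_(r \in range g)
      ((r * \1_(g @^-1` [set r]) x)%:E * (f x)%:E)); last first.
    apply: eq_integral => x _; rewrite fimfunE -fsumEFin// ge0_mule_fsuml// => r.
    exact: nnfun_muleindic_ge0.
  rewrite !ge0_integral_fsum//.
  - apply: eq_fsbigr => r _; have [r_ge0|r_lt0] := leP 0%R r; last first.
      rewrite !integral0_eq// => x _; rewrite preimage_nnfun0// indic0 mulr0//.
      by rewrite mul0e.
    under eq_integral do rewrite EFinM.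
    under [RHS]eq_integral do rewrite EFinM -muleA.
    rewrite !ge0_integralZl// ?indicE//.
    + by apply: emeasurable_funM => //; exact/measurable_EFinP.
    + by move=> x _; rewrite mule_ge0 ?lee_fin.
    + exact/measurable_EFinP.
  - by move=> r; apply: emeasurable_funM.
  - by move=> r x _; rewrite mule_ge0 ?lee_fin//; exact: nnfun_muleindic_ge0.
  - by move=> r x _; exact: nnfun_muleindic_ge0.
pose g := nnsfun_approx measurableT mh.
have gh x : (g n x)%:E @[n --> \oo] --> h x by exact: cvg_nnsfun_approx.
have g_nd x : nondecreasing_seq (fun n => (g n x)%:E).
  by move=> k l kl; rewrite lee_fin; exact/lefP/nd_nnsfun_approx.
transitivity (limn (fun n => \int[nu]_x (g n x)%:E)).
  rewrite -monotone_convergence//.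
  - by apply: eq_integral => x _; exact/esym/cvg_lim.
  - by move=> n; exact/measurable_EFinP.
  - by move=> n x _; rewrite lee_fin.
under eq_fun do rewrite simpleE.
rewrite -monotone_convergence//.
- by apply: eq_integral => x _; apply: cvg_lim => //; exact: cvgeZr.
- by move=> n; apply: emeasurable_funM => //; exact/measurable_EFinP.
- by move=> n x _; rewrite mule_ge0 ?lee_fin.
- by move=> x _ k l kl; rewrite lee_wpmul2r ?lee_fin ?g_nd//; exact/lefP/nd_nnsfun_approx.
Qed.

End density.

(** Tonelli on the iterated product [(X * Y) * Z] asks this of its first factor. *)
Lemma product_sigma_finite d1 d2 (X : measurableType d1) (Y : measurableType d2)
    (R : realType) (m1 : {sigma_finite_measure set X -> \bar R})
    (m2 : {sigma_finite_measure set Y -> \bar R}) :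
  sigma_finite setT (m1 \x m2)%E.
Proof.
have /sigma_finiteP[F [TF ndF Foo]] := sigma_finiteT m1.
have /sigma_finiteP[G [TG ndG Goo]] := sigma_finiteT m2.
exists (fun n => F n `*` G n) => [|k].
  apply/seteqP; split => // -[x y] _.
  have [k _ Fx] : (\bigcup_k F k) x by rewrite -TF.
  have [l _ Gy] : (\bigcup_k G k) y by rewrite -TG.
  exists (maxn k l) => //; split => /=.
  - by move: x Fx; exact/subsetPset/ndF/leq_maxl.
  - by move: y Gy; exact/subsetPset/ndG/leq_maxr.
have [mF Fk] := Foo k; have [mG Gk] := Goo k; split; first exact: measurableX.
by rewrite product_measure1E// lte_mul_pinfty// ge0_fin_numE.
Qed.

Section disintegration.
Local Open Scope ereal_scope.
Context d1 d2 d3 (X : measurableType d1) (Y : measurableType d2)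
  (Z : measurableType d3) (R : realType).
Variables (m1 : {sigma_finite_measure set X -> \bar R})
  (m2 : {sigma_finite_measure set Y -> \bar R})
  (m3 : {sigma_finite_measure set Z -> \bar R}).
Variable f : X * Y * Z -> R.
Hypotheses (mf : measurable_fun setT f) (f_ge0 : forall w, (0 <= f w)%R).

(** The mass of the fibre of [D] over [x]: normalized, it is the conditional law. *)
Definition fiber_mass x (D : set (X * Y * Z)) : \bar R :=
  \int[m2]_y \int[m3]_z ((f (x, y, z))%:E * (\1_D (x, y, z))%:E).

Let measurable_integrand D : measurable D ->
  measurable_fun setT (fun w => (f w)%:E * (\1_D w)%:E).
Proof. by move=> mD; apply: emeasurable_funM; exact/measurable_EFinP. Qed.

Let integrand_ge0 D w : 0 <= (f w)%:E * (\1_D w)%:E.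
Proof. by rewrite mule_ge0 ?lee_fin. Qed.

Let phi x (u : Y * Z) : X * Y * Z := (x, u.1, u.2).

Let measurable_phi x : measurable_fun setT (phi x).
Proof. by apply/measurable_fun_pair => //; exact/measurable_fun_pair. Qed.

Let measurable_fiber x D : measurable D -> measurable (phi x @^-1` D).
Proof. by move=> mD; rewrite -[X in measurable X]setTI; exact: measurable_phi. Qed.

(** As a single integral over the section of [D], the fibre mass is visibly
countably additive in [D]. *)
Lemma fiber_massE x D : measurable D ->
  fiber_mass x D = \int[m2 \x m3]_(u in phi x @^-1` D) (f (phi x u))%:E.
Proof.
move=> mD; rewrite integral_mkcond fubini_tonelli1; last 2 first.
- rewrite epatch_indic; apply: emeasurable_funM; apply/measurable_EFinP.
    exact: measurableT_comp.
  by apply: measurable_indic; exact: measurable_fiber.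
- by move=> u; rewrite epatch_indic mule_ge0 ?lee_fin.
by apply: eq_integral => y _; apply: eq_integral => z _; rewrite epatch_indic.
Qed.

Let fiber_mass0 x : fiber_mass x set0 = 0.
Proof. by rewrite fiber_massE// preimage_set0 integral_set0. Qed.

Let fiber_mass_ge0 x D : 0 <= fiber_mass x D.
Proof. by apply: integral_ge0 => y _; exact: integral_ge0. Qed.

Let fiber_mass_sigma_additive x : semi_sigma_additive (fiber_mass x).
Proof.
move=> F mF tF mUF; rewrite fiber_massE// preimage_bigcup.
under eq_fun do under eq_bigr do rewrite fiber_massE//.
apply: (@semi_sigma_additive_nng_induced _ _ _ (m2 \x m3)
  (fun u => (f (phi x u))%:E) _ _ (fun k => phi x @^-1` F k)).
- by apply/measurable_EFinP; exact: measurableT_comp.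
- by move=> u; rewrite lee_fin.
- by move=> k; exact: measurable_fiber.
- by move=> i j _ _ [u [? ?]]; apply: tF => //; exists (phi x u).
- by rewrite -preimage_bigcup; exact: measurable_fiber.
Qed.

Lemma measurable_fiber_mass D : measurable D -> measurable_fun setT (fiber_mass ^~ D).
Proof.
move=> mD; pose g w := (f w)%:E * (\1_D w)%:E.
apply: (measurable_fun_fubini_tonelli_F (m2 := m2) (fubini_F m3 g)).
  apply: measurable_fun_fubini_tonelli_F; first exact: (measurable_integrand mD).
  exact: (@integrand_ge0 D).
by move=> w; apply: integral_ge0 => z _; exact: integrand_ge0.
Qed.

Lemma fiber_kernel :
  exists N : R.-ker X ~> (X * Y * Z)%type, forall x D, N x D = fiber_mass x D.
Proof.
pose N x : {measure set (X * Y * Z) -> \bar R} := HB.pack (fiber_mass x)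
  (isMeasure.Build _ _ _ (fiber_mass x) (fiber_mass0 x) (fiber_mass_ge0 x)
    (@fiber_mass_sigma_additive x)).
pose K : R.-ker X ~> (X * Y * Z)%type :=
  HB.pack N (isKernel.Build _ _ _ _ _ N measurable_fiber_mass).
by exists K.
Qed.

Lemma integral_fiber_mass (h : X -> \bar R) D :
  measurable_fun setT h -> (forall x, 0 <= h x) -> measurable D ->
  \int[(m1 \x m2) \x m3]_w (h w.1.1 * ((f w)%:E * (\1_D w)%:E)) =
  \int[m1]_x (h x * fiber_mass x D).
Proof.
move=> mh h_ge0 mD.
pose g0 w := (f w)%:E * (\1_D w)%:E.
have mg0 : measurable_fun setT g0 by exact: measurable_integrand.
have g0_ge0 w : 0 <= g0 w by exact: integrand_ge0.
pose g (w : X * Y * Z) := h w.1.1 * g0 w.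
have mg : measurable_fun setT g.
  apply: emeasurable_funM => //.
  by apply: measurableT_comp => //; exact: measurableT_comp.
have g_ge0 w : 0 <= g w by exact: mule_ge0.
have mG0 : measurable_fun setT (fubini_F m3 g0) by exact: measurable_fun_fubini_tonelli_F.
have mG : measurable_fun setT (fubini_F m3 g) by exact: measurable_fun_fubini_tonelli_F.
pose m12 : {sigma_finite_measure set (X * Y)%type -> \bar R} := HB.pack (m1 \x m2)
  (@Measure_isSigmaFinite.Build _ _ _ (m1 \x m2) (product_sigma_finite m1 m2)).
transitivity (\int[m12 \x m3]_w g w); first by [].
rewrite fubini_tonelli1//; transitivity (\int[m1 \x m2]_v fubini_F m3 g v); first by [].
rewrite fubini_tonelli1//; last by move=> v; exact: integral_ge0.
apply: eq_integral => x _; rewrite /fubini_F /fiber_mass.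
rewrite -ge0_integralZl//; last 2 first.
- exact: (measurableT_comp mG0 (measurable_pair1 x)).
- by move=> y _; exact: integral_ge0.
apply: eq_integral => y _; rewrite -ge0_integralZl//.
exact: (measurableT_comp mg0 (measurable_pair1 (x, y))).
Qed.

Hypothesis fiber_mass_gt0 : forall x, 0 < fiber_mass x setT.
Hypothesis fiber_mass_lty : forall x, fiber_mass x setT < +oo.

(** The kernel is the normalized fibre mass. The joint law of the first coordinate
and [D] integrates the fibre mass of [D]; the same integral results from
integrating the normalized fibre mass of [D] against the density, because the
total fibre mass cancels the normalization. *)
Theorem disintegration (nu : {measure set (X * Y * Z) -> \bar R}) :
  (forall D, measurable D -> nu D = \int[(m1 \x m2) \x m3]_(w in D) (f w)%:E) ->
  exists2 P : R.-pker X ~> (X * Y * Z)%type,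
    is_cond_law nu (fun w => w.1.1) P &
    forall x D, P x D = fiber_mass x D * (fine (fiber_mass x setT))^-1%:E.
Proof.
move=> nuE; have [N NE] := fiber_kernel.
(* All total masses are positive and finite, so [knormalize] divides by them. *)
pose P : R.-pker X ~> (X * Y * Z)%type := knormalize N (dirac point).
have PE x D : P x D = fiber_mass x D * (fine (fiber_mass x setT))^-1%:E.
  rewrite /P /= /mnormalize !NE gt_eqF//= lt_eqF//.
  by rewrite NE.
have mass_fin x : fiber_mass x setT \is a fin_num.
  by rewrite ge0_fin_numE.
exists P => // A D mA mD.
have mfst : measurable_fun setT (fun w : X * Y * Z => w.1.1) by exact: measurableT_comp.
have mA' : measurable ((fun w : X * Y * Z => w.1.1) @^-1` A).
  by rewrite -[X in measurable X]setTI; exact: mfst.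
have mP : measurable_fun setT (fun x => P x D) by exact: measurable_kernel.
have mindA : measurable_fun setT (fun x : X => (\1_A x)%:E : \bar R).
  by apply/measurable_EFinP; exact: measurable_indic.
transitivity (\int[m1]_x ((\1_A x)%:E * fiber_mass x D)).
  rewrite nuE; last exact: measurableI.
  rewrite -integral_fiber_mass// integral_mkcond; apply: eq_integral => w _.
  by rewrite epatch_indic indicI /= EFinM muleC -!muleA [X in _ * X]muleC.
rewrite [RHS]integral_mkcond epatch_indic.
rewrite (@ge0_integral_density _ _ _ ((m1 \x m2) \x m3) nu f)//; last 2 first.
- apply: emeasurable_funM; first exact: (measurableT_comp mP mfst).
  exact/measurable_EFinP/measurable_indic.
- by move=> w; rewrite mule_ge0 ?lee_fin.
transitivity (\int[m1]_x ((\1_A x)%:E * P x D * fiber_mass x setT)).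
  apply: eq_integral => x _; rewrite PE -!muleA; congr (_ * _).
  rewrite -[X in _ * (_ * X)]fineK// -EFinM mulVf ?mule1//.
  by rewrite fine_eq0// gt_eqF.
rewrite -(integral_fiber_mass (h := fun x => (\1_A x)%:E * P x D))//.
  apply: eq_integral => w _; rewrite indicT mule1 /=.
  by rewrite [X in X * _ = _]muleC.
by apply: emeasurable_funM.
Qed.

End disintegration.

(** * Finiteness of the fibre mass *)

Section tree_counting_integral.
Local Open Scope ereal_scope.
Variables (R : realType) (V : finType) (e : rel V).

Lemma integral_tree_counting (g : spanning_tree e -> R) : (forall T, (0 <= g T)%R) ->
  \int[@tree_counting V e R]_T (g T)%:E = (\sum_T g T)%:E.
Proof.
move=> g_ge0.
have gE T : (g T)%:E = \sum_(S : spanning_tree e) (g S)%:E * (\1_[set S] T)%:E.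
  rewrite (bigD1 T)//= indicE mem_set// mule1 big1 ?adde0// => S ST.
  by rewrite indicE memNset ?mule0//= => TS; rewrite TS eqxx in ST.
under eq_integral do rewrite gE.
rewrite ge0_integral_sum//; last by move=> S T _; rewrite mule_ge0 ?lee_fin.
rewrite -sumEFin; apply: eq_bigr => S _.
rewrite ge0_integralZl//; last by rewrite lee_fin.
rewrite integral_indic// setIT /= /tree_counting /counting asboolT//.
by rewrite fset_set1 finmap.cardfs1 mule1.
Qed.

End tree_counting_integral.

Section gaussian_tuple.
Local Open Scope ereal_scope.
Variable R : realType.

Lemma measurable_gaussian (k : R) :
  measurable_fun setT (fun x : measurableTypeR R => (expR (- (k * x ^+ 2)))%:E).
Proof.
apply/measurable_EFinP; apply: measurableT_comp => //; apply: measurable_funN.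
by apply: measurable_funM => //; exact: measurable_funX.
Qed.

(** Up to a constant, the integrand is the normal density of variance
[1 / (2 k)]. *)
Lemma gaussian_integral_lty (k : R) : (0 < k)%R ->
  \int[@lebesgue_measure R]_x (expR (- (k * x ^+ 2)))%:E < +oo.
Proof.
move=> k_gt0; pose s : R := Num.sqrt (2 * k)^-1.
have s2 : (s ^+ 2 = (2 * k)^-1)%R by rewrite sqr_sqrtr// invr_ge0 mulr_ge0 ?ltW.
have s0 : s != 0%R by rewrite gt_eqF// sqrtr_gt0 invr_gt0 mulr_gt0.
have pdfE x : normal_pdf 0 s x = (normal_peak s * expR (- (k * x ^+ 2)))%R.
  rewrite normal_pdfE// /normal_fun subr0 s2; congr (_ * expR _)%R.
  by field; rewrite gt_eqF.
have := @integral_normal_pdf R 0 s; under eq_integral do rewrite pdfE EFinM.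
rewrite ge0_integralZl//; last 2 first.
- exact: measurable_gaussian.
- by rewrite lee_fin normal_peak_ge0.
set I := integral _ _ _ => peakI; rewrite ltNge leye_eq; apply/eqP => Iy.
by move: peakI; rewrite Iy gt0_muley// lte_fin normal_peak_gt0.
Qed.

Lemma measurable_gaussian_tuple n (k : 'I_n -> R) :
  measurable_fun setT (fun s : n.-tuple (measurableTypeR R) =>
    (\prod_i expR (- (k i * tnth s i ^+ 2)))%R).
Proof.
rewrite /index_enum; apply: measurable_prod => i _; apply: measurableT_comp => //.
apply: measurable_funN; apply: measurable_funM => //; apply: measurable_funX.
exact: (@measurable_tnth _ (measurableTypeR R) n i).
Qed.

Lemma gaussian_tuple_integral_lty n (k : 'I_n -> R) : (forall i, (0 < k i)%R) ->
  \int[lebesgue_tuple R n]_s (\prod_i expR (- (k i * tnth s i ^+ 2)))%:E < +oo.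
Proof.
elim: n k => [|n IHn] k k_gt0.
  under eq_integral do rewrite big_ord0.
  by rewrite integral_cst//= mul1e diracT ltry.
rewrite [X in \int[X]_s _]/= /lebesgue_cons ge0_integral_pushforward//; last 3 first.
- exact: measurable_tuple_cons.
- by apply/measurable_EFinP; exact: measurable_gaussian_tuple.
- by move=> s _; rewrite lee_fin prodr_ge0.
rewrite preimage_setT fubini_tonelli1; last 2 first.
- apply/measurable_EFinP.
  exact: (measurableT_comp (measurable_gaussian_tuple k) (@measurable_tuple_cons R n)).
- by move=> p; rewrite lee_fin prodr_ge0.
pose I := \int[lebesgue_tuple R n]_s
  (\prod_i expR (- (k (lift ord0 i) * tnth s i ^+ 2)))%:E.
have I_lty : I < +oo by exact: IHn.
have I_ge0 : 0 <= I by apply: integral_ge0 => s _; rewrite lee_fin prodr_ge0.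
rewrite (eq_integral (fun x : measurableTypeR R => (expR (- (k ord0 * x ^+ 2)))%:E * I)) => [|x _].
  rewrite ge0_integralZr//.
  - by rewrite lte_mul_pinfty ?gaussian_integral_lty ?ge0_fin_numE ?gaussian_integral_lty//;
      apply: integral_ge0 => x _; rewrite lee_fin expR_ge0.
  - exact: measurable_gaussian.
rewrite /fubini_F /I -ge0_integralZl//.
- apply: eq_integral => s _ /=; rewrite big_ord_recl -EFinM tnth0.
  by congr (_ * _)%:E; apply: eq_bigr => i _; rewrite tnthS.
- by apply/measurable_EFinP; exact: measurable_gaussian_tuple.
- by move=> s _; rewrite lee_fin prodr_ge0.
Qed.

Lemma lebesgue_tuple_neq0 n : lebesgue_tuple R n setT != 0.
Proof.
have := @lebesgue_tuple_box R n (fun=> setT) (fun=> measurableT).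
rewrite [X in lebesgue_tuple R n X](_ : _ = setT); last by apply/seteqP; split.
move=> ->; apply: (big_ind (fun z : \bar R => z != 0)) => [|y z|i _].
- by rewrite onee_neq0.
- exact: mule_neq0.
- by rewrite -set_itvNyy lebesgue_measure_itv.
Qed.

End gaussian_tuple.

Section edge_energy.
Variables (R : realType) (V : finType) (e : rel V).
Hypothesis e_conn : forall i j, connect e i j.
Variable beta : V -> V -> R.
Hypothesis beta_sym : forall i j, e i j -> beta i j = beta j i.
Hypothesis beta_gt0 : forall i j, e i j -> 0 < beta i j.
Variable eps : V -> R.
Hypothesis eps_ge0 : forall i, 0 <= eps i.
Variable root : V.
Hypothesis eps_root : 0 < eps root.
Implicit Types t s : vec R V.

Definition bond_energy t s a b : R := ext_weight beta eps a b * (B_ t s a b - 1).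

Definition total_energy t s : R := \sum_(E in ext_edges e) edge_fun (bond_energy t s) E.

Definition spin_density t s : R :=
  \prod_(E in ext_edges e)
     edge_fun (fun a b => expR (- (ext_weight beta eps a b * (B_ t s a b - 1)))) E.

Lemma ext_weight_sym a b : ext_adj e a b ->
  ext_weight beta eps a b = ext_weight beta eps b a.
Proof. by case: a b => [i|] [j|] //=; exact: beta_sym. Qed.

Lemma B_sym t s a b : B_ t s a b = B_ t s b a.
Proof.
rewrite /B_ /cosh !opprB [X in X / 2]addrC; congr (_ + _ * expR _); last exact: addrC.
by congr (_ * _); rewrite -sqrrN opprB.
Qed.

Lemma bond_energy_sym t s a b : ext_adj e a b -> bond_energy t s a b = bond_energy t s b a.
Proof. by move=> ab; rewrite /bond_energy ext_weight_sym// B_sym. Qed.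

(** Written additively, the density can be compared with the energy of one edge. *)
Lemma spin_densityE t s : spin_density t s = expR (- total_energy t s).
Proof.
rewrite /spin_density /total_energy -sumrN expR_sum.
apply: eq_bigr => E /imsetP[[a b]]; rewrite inE /= => ab ->.
by rewrite !edge_funE// -?/(bond_energy _ _ _ _) bond_energy_sym.
Qed.

Lemma cosh_ge1 (r : R) : 1 <= cosh r.
Proof.
rewrite /cosh expRN; have := expR_gt0 r; set z := expR r => z_gt0.
rewrite ler_pdivlMr// mul1r -subr_ge0.
have -> : z + z^-1 - 2 = (z - 1) ^+ 2 / z by field; rewrite gt_eqF.
by rewrite divr_ge0 ?sqr_ge0// ltW.
Qed.

Lemma bond_energy_ge t s a b : ext_adj e a b ->
  ext_weight beta eps a b * (2^-1 * expR (ext_coord t a + ext_coord t b)) *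
    (ext_coord s a - ext_coord s b) ^+ 2 <= bond_energy t s a b.
Proof.
move=> ab; rewrite /bond_energy -mulrA ler_wpM2l//.
  by apply: ext_weight_ge0 ab => // i j /beta_gt0/ltW.
have := cosh_ge1 (ext_coord t a - ext_coord t b); rewrite /B_.
by rewrite [2^-1 * _ * _]mulrAC addrAC lerDr subr_ge0.
Qed.

Lemma bond_energy_ge0 t s a b : ext_adj e a b -> 0 <= bond_energy t s a b.
Proof.
move=> ab; apply: le_trans (bond_energy_ge t s ab).
apply: mulr_ge0 (sqr_ge0 _); apply: mulr_ge0; last by rewrite mulr_ge0 ?expR_ge0.
by apply: ext_weight_ge0 ab => // i j /beta_gt0/ltW.
Qed.

Lemma bond_energy_le_total t s a b : ext_adj e a b ->
  bond_energy t s a b <= total_energy t s.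
Proof.
move=> ab; have Eab : [set a; b]%SET \in ext_edges e.
  by apply/imsetP; exists (a, b); rewrite ?inE.
rewrite /total_energy (bigD1 _ Eab)/= edge_funE; last exact: bond_energy_sym.
rewrite lerDl; apply: sumr_ge0 => E /andP[/imsetP[[c d]]]; rewrite inE /= => cd -> _.
by rewrite edge_funE ?bond_energy_ge0//; exact: bond_energy_sym.
Qed.

Lemma gap_le_energy t a b : ext_adj e a b -> 0 < ext_weight beta eps a b ->
  exists2 C : R, 0 < C &
    forall s, (ext_coord s a - ext_coord s b) ^+ 2 <= C * total_energy t s.
Proof.
move=> ab w_gt0.
pose c := ext_weight beta eps a b * (2^-1 * expR (ext_coord t a + ext_coord t b)).
have c_gt0 : 0 < c by rewrite !mulr_gt0 ?expR_gt0.
exists c^-1; first by rewrite invr_gt0.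
move=> s; rewrite ler_pdivlMl//.
exact: le_trans (bond_energy_ge t s ab) (bond_energy_le_total t s ab).
Qed.

(** Along a path from [v] to [root], and then to [None] where the spin is zero, each
gap is controlled by the energy of its edge. *)
Lemma spin_le_energy t v : exists2 C : R, 0 < C &
  forall s, ext_coord s (Some v) ^+ 2 <= C * total_energy t s.
Proof.
have /connectP[p] := e_conn v root; elim: p v => [v _ /= <-|w p IHp v /= /andP[vw ep] rootE].
  have [//|C C_gt0 HC] := @gap_le_energy t (Some root) None isT.
  by exists C => // s; have := HC s; rewrite /= subr0.
have [C C_gt0 HC] := IHp _ ep rootE.
have [|C' C'_gt0 HC'] := @gap_le_energy t (Some v) (Some w) vw; first exact: beta_gt0.
exists (2 * (C + C')); first by rewrite mulr_gt0// addr_gt0.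
move=> s; rewrite -[tnth s _]/(ext_coord s (Some v)).
have := HC s; have := HC' s.
set sv := ext_coord s (Some v); set sw := ext_coord s (Some w).
set Q := total_energy t s; move: sv sw Q => sv sw Q Hvw Hw.
rewrite -subr_ge0.
(* [sv ^ 2 <= 2 (sv - sw) ^ 2 + 2 sw ^ 2], the defect being a square. *)
have -> : 2 * (C + C') * Q - sv ^+ 2 =
  2 * (C' * Q - (sv - sw) ^+ 2) + 2 * (C * Q - sw ^+ 2) + (sv - 2 * sw) ^+ 2 by ring.
by rewrite !addr_ge0 ?sqr_ge0// mulr_ge0 ?subr_ge0.
Qed.

Lemma spin_density_gt0 t s : 0 < spin_density t s.
Proof. by rewrite spin_densityE expR_gt0. Qed.

Lemma measurable_spin_density t : measurable_fun setT (spin_density t).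
Proof.
rewrite (_ : spin_density t = fun s => \prod_(E <- enum (ext_edges e))
    edge_fun (fun a b => expR (- (ext_weight beta eps a b * (B_ t s a b - 1)))) E);
  last by apply/funext => s; rewrite big_enum.
apply: measurable_prod => E _; apply: measurable_edge_fun => a b.
have ms c : measurable_fun setT (fun s : vec R V => ext_coord s c).
  exact: measurable_ext_coord.
apply: measurableT_comp => //; apply: measurable_funN; apply: measurable_funM => //.
apply: measurable_funB => //; apply: measurable_funD => //.
apply: measurable_funM => //; apply: measurable_funM => //; apply: measurable_funX.
exact: measurable_funB.
Qed.

(** The bounds of all the spins by the energy are averaged over [V]. *)
Lemma spin_density_gaussian t : exists2 k : 'I_#|V| -> R, (forall i, 0 < k i) &
  forall s, spin_density t s <= \prod_i expR (- (k i * tnth s i ^+ 2)).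
Proof.
have /choice[C CP] v : exists C : R, 0 < C /\
    forall s, ext_coord s (Some v) ^+ 2 <= C * total_energy t s.
  by have [C] := spin_le_energy t v; exists C.
have V_gt0 : (0 : R) < #|V|%:R by rewrite ltr0n; apply/card_gt0P; exists root.
(* Each vertex may spend the fraction [1 / #|V|] of the energy. *)
exists (fun i => (C (enum_val i) * #|V|%:R)^-1) => [i|s].
  by rewrite invr_gt0 mulr_gt0//; have [] := CP (enum_val i).
rewrite spin_densityE -expR_sum ler_expR sumrN lerN2.
apply: (@le_trans _ _ (\sum_(i < #|V|) total_energy t s / #|V|%:R)).
  apply: ler_sum => i _; have [C_gt0] := CP (enum_val i) => /(_ s).
  rewrite /= enum_valK => HC.
  rewrite invfM mulrAC ler_pM2r ?invr_gt0//.
  by rewrite ler_pdivrMl.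
by rewrite sumr_const card_ord -[_ / _ *+ _]mulr_natr divfK ?gt_eqF.
Qed.

(** Finite by domination, positive because the integrand is positive everywhere and
the Lebesgue measure does not vanish. *)
Lemma integral_spin_density t :
  exists2 r : R, 0 < r & (\int[lebesgue_tuple R #|V|]_s (spin_density t s)%:E = r%:E)%E.
Proof.
have mD : measurable_fun setT (fun s => (spin_density t s)%:E).
  by apply/measurable_EFinP; exact: measurable_spin_density.
pose mass := (\int[lebesgue_tuple R #|V|]_s (spin_density t s)%:E)%E.
have mass_ge0 : (0 <= mass)%E.
  by apply: integral_ge0 => s _; rewrite lee_fin ltW// spin_density_gt0.
have mass_lty : (mass < +oo)%E.
  have [k k_gt0 Dk] := spin_density_gaussian t.
  apply: le_lt_trans (gaussian_tuple_integral_lty k_gt0).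
  apply: ge0_le_integral => //.
  - by move=> s _; rewrite lee_fin ltW// spin_density_gt0.
  - by apply/measurable_EFinP; exact: measurable_gaussian_tuple.
  - by move=> s _; rewrite lee_fin.
have mass_neq0 : (mass != 0)%E.
  apply/eqP => mass0.
  have /(ae_eq_integral_abs (lebesgue_tuple R #|V|) measurableT mD) :
      (\int[lebesgue_tuple R #|V|]_(s in setT) `|(spin_density t s)%:E| = 0)%E.
    rewrite -[RHS]mass0; apply: eq_integral => s _.
    by rewrite gee0_abs// lee_fin ltW// spin_density_gt0.
  move=> [N [mN N0 subN]]; have /eqP := lebesgue_tuple_neq0 R #|V|; apply.
  apply/eqP; rewrite eq_le measure_ge0 andbT -N0.
  apply: le_measure; rewrite ?inE// => s _; apply: subN => /=.
  by move=> /(_ I)/eqP; rewrite eqe gt_eqF// spin_density_gt0.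
exists (fine mass); last by rewrite fineK// ge0_fin_numE.
by apply: fine_gt0; rewrite lt0e mass_neq0 mass_ge0 mass_lty.
Qed.

End edge_energy.

(** * The conditional law of the tree *)

Section tree_law.
Variables (R : realType) (V : finType) (e : rel V).
Hypotheses (e_sym : symmetric e) (e_conn : forall i j, connect e i j).
Variable beta : V -> V -> R.
Hypothesis beta_sym : forall i j, e i j -> beta i j = beta j i.
Hypothesis beta_gt0 : forall i j, e i j -> 0 < beta i j.
Variable eps : V -> R.
Hypothesis eps_ge0 : forall i, 0 <= eps i.
Variable root : V.
Hypothesis eps_root : 0 < eps root.
Implicit Types t s : vec R V.

Local Notation density := (@mu_density R V e beta eps).

Definition volume_factor t : R := \prod_(j : V) (expR (- ext_coord t (Some j)) / (2 * pi)).

Lemma volume_factor_gt0 t : 0 < volume_factor t.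
Proof. by apply: prodr_gt0 => j _; rewrite divr_gt0 ?expR_gt0// mulr_gt0 ?pi_gt0. Qed.

Lemma tree_weight_ge0 t (T : spanning_tree e) : 0 <= tree_weight beta eps t (tree_edges T).
Proof.
have [/fintype.subsetP TE _ _] := asboolW (valP T).
apply: prodr_ge0 => E /TE; apply: (edge_fun_ge0 e_sym) => a b ab.
by rewrite mulr_ge0 ?expR_ge0 ?(ext_weight_ge0 _ eps_ge0 ab)// => i j /beta_gt0/ltW.
Qed.

(** The factor [r] gathers the [t]-dependent prefactor and the integral over [s]. It
does not depend on the event, and thus cancels in conditional probabilities. *)
Lemma fiber_mass_trees t : exists2 r : R, 0 < r &
  forall (D : set (sample_space R V e)) (Q : pred (spanning_tree e)),
    (forall w, D w <-> Q w.2) ->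
    fiber_mass (lebesgue_tuple R #|V|) (@tree_counting V e R) density t D =
    (r * \sum_(T : spanning_tree e) tree_weight beta eps t (tree_edges T) *+ Q T)%:E.
Proof.
have [r r_gt0 rE] := integral_spin_density e_conn beta_sym beta_gt0 eps_ge0 eps_root t.
exists (volume_factor t * r) => [|D Q DQ]; first by rewrite mulr_gt0 ?volume_factor_gt0.
set W := \sum_T _; rewrite /fiber_mass.
have W_ge0 : 0 <= W by apply: sumr_ge0 => T _; rewrite mulrn_wge0 ?tree_weight_ge0.
transitivity (\int[lebesgue_tuple R #|V|]_s
    ((volume_factor t * W)%:E * (spin_density e beta eps t s)%:E))%E.
  apply: eq_integral => s _.
  have c_ge0 : 0 <= volume_factor t * spin_density e beta eps t s.
    by rewrite mulr_ge0// ltW ?volume_factor_gt0 ?spin_density_gt0.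
  transitivity (\int[@tree_counting V e R]_T (volume_factor t *
      spin_density e beta eps t s * (tree_weight beta eps t (tree_edges T) *+ Q T))%:E)%E.
    apply: eq_integral => T _; rewrite -EFinM; congr EFin.
    have -> : \1_D (t, s, T) = (Q T)%:R :> R.
      rewrite indicE; congr (nat_of_bool _)%:R; apply/idP/idP; first by rewrite inE => /DQ.
      by move=> QT; rewrite inE; apply/DQ.
    by rewrite mulr_natr -mulrnAr.
  rewrite integral_tree_counting -?mulr_sumr; last first.
    by move=> T; rewrite mulr_ge0// mulrn_wge0// tree_weight_ge0.
  by rewrite -EFinM mulrAC.
rewrite ge0_integralZl//.
- by rewrite rE -EFinM mulrAC.
- by apply/measurable_EFinP; exact: measurable_spin_density.
- by move=> s _; rewrite lee_fin ltW// spin_density_gt0.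
- by rewrite lee_fin mulr_ge0// ltW// volume_factor_gt0.
Qed.

Hypothesis tree_weight_sum_gt0 : forall t,
  0 < \sum_(T : spanning_tree e) tree_weight beta eps t (tree_edges T).

Theorem conditional_tree_law : exists2 P : R.-pker (vec R V) ~> (sample_space R V e),
  is_cond_law (@mu R V e beta eps) (@rv_t R V e) P &
  forall t (D : set (sample_space R V e)) (Q : pred (spanning_tree e)),
    (forall w, D w <-> Q (rv_T w)) ->
    P t D =
    ((\sum_(T : spanning_tree e) tree_weight beta eps t (tree_edges T) *+ Q T) /
     \sum_(T : spanning_tree e) tree_weight beta eps t (tree_edges T))%:E.
Proof.
have beta_ge0 i j : e i j -> 0 <= beta i j by move=> /beta_gt0/ltW.
have massT t : exists2 r : R, 0 < r &
    fiber_mass (lebesgue_tuple R #|V|) (@tree_counting V e R) density t setT = r%:E.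
  have [r r_gt0 /(_ setT predT) rE] := fiber_mass_trees t.
  by exists (r * \sum_(T : spanning_tree e) tree_weight beta eps t (tree_edges T));
    [rewrite mulr_gt0|exact: rE].
have [||P P_cond PE] := @disintegration _ _ _ _ _ _ R (lebesgue_tuple R #|V|)
    (lebesgue_tuple R #|V|) (@tree_counting V e R) density
    (@measurable_mu_density R V e beta eps)
    (fun w => mu_density_ge0 e_sym beta_ge0 eps_ge0 w) _ _
    (mu_measure e_sym beta_ge0 eps_ge0) (fun D _ => erefl).
- by move=> t; have [r r_gt0 ->] := massT t; rewrite lte_fin.
- by move=> t; have [r r_gt0 ->] := massT t; rewrite ltry.
exists P => // t D Q DQ; have [r r_gt0 rE] := fiber_mass_trees t.
rewrite PE (rE D Q DQ) (rE setT predT)//= -EFinM; congr EFin.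
by rewrite -mulf_div divff ?mul1r// gt_eqF.
Qed.

End tree_law.

Theorem lemma2p1 (R : realType) (V : finType) (e : rel V)
    (e_sym : symmetric e) (e_irr : irreflexive e)
    (e_conn : forall i j, connect e i j)
    (beta : V -> V -> R)
    (beta_sym : forall i j, e i j -> beta i j = beta j i)
    (beta_gt0 : forall i j, e i j -> 0 < beta i j)
    (x y : V) (xy : x != y)
    (p : V -> R) (p_ge0 : forall i, 0 <= p i) (px : 0 < p x) (py : 0 < p y)
    (epsilon : R) (epsilon_gt0 : 0 < epsilon) :
  let eps := fun i => p i * epsilon in
  exists P : R.-pker (vec R V) ~> (sample_space R V e),
    [/\ is_cond_law (@mu R V e beta eps) (@rv_t R V e) P,
        forall (t : vec R V) (S : spanning_tree e),
          P t [set w | rv_T w = S] =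
          ((\prod_(E in tree_edges S) edge_weight beta eps t E) /
           (\sum_(S' : spanning_tree e)
              \prod_(E in tree_edges S') edge_weight beta eps t E))%:E
      & forall t : vec R V,
          (green e beta eps t x y)%:E =
          ((expR (ext_coord t (Some x) + ext_coord t (Some y)) /
            (eps x * expR (ext_coord t (Some x)) + eps y * expR (ext_coord t (Some y))))%:E *
           P t ([set w | edge_rel (tree_edges (rv_T w)) (Some x) None /\
                         tree_connected (rv_T w) x y] `|`
                [set w | edge_rel (tree_edges (rv_T w)) (Some y) None /\
                         tree_connected (rv_T w) x y]))%E].
Proof.
move=> eps.
have eps_ge0 i : 0 <= eps i by rewrite mulr_ge0// ltW.
have eps_x : 0 < eps x by rewrite mulr_gt0.
have eps_y : 0 < eps y by rewrite mulr_gt0.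
have [|P P_cond PE] :=
    conditional_tree_law e_sym e_conn beta_sym beta_gt0 eps_ge0 eps_x.
  move=> t; have := sum_tree_weight e_sym e_irr beta_sym eps t predT.
  by rewrite /= => ->; exact: conductance_tree_sum_gt0 eps_x t.
exists P; split => // [t S|t].
  rewrite (PE t _ (pred1 S)) => [|w]; last by split => /eqP.
  rewrite (bigD1 S)//= eqxx mulr1n big1 ?addr0// => T /negbTE TS.
  by rewrite TS mulr0n.
rewrite (PE t _ (fun T => rooted_link x y (tree_edges T))) => [|w].
  by rewrite -EFinM (green_rooted_link e_sym e_irr e_conn beta_sym beta_gt0 eps_ge0 eps_x).
rewrite /rooted_link; split; first by case=> /= /andP ?; apply/orP; [left|right].
by move=> /orP[] /andP[]; [left|right].
Qed.
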